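(* Let $y\in M$ be such that $({\rm A}_y^+)$ holds with the fundamental solution $\Gamma=\Gamma_y$ in $T_y$. Let $\Omega\subset T_y$, $y\notin\partial\Omega$, be an admissible domain and let $u\in C^1(\Omega)\cap C(\overline{\Omega})$. Then for $\beta>2$ (and with $R\ge e\,\sup_{\Omega}\Gamma^{\frac{1}{2-\beta}}$) we have $$\int_{\Omega}\Gamma^{\frac{2}{2-\beta}}|\nabla_X\Gamma^{\frac{1}{2-\beta}}|^2|u|^2\,d\nu\int_{\Omega}|\nabla_Xu|^2\,d\nu\ge\left(\frac{\beta-2}{2}\right)^2\left(\int_{\Omega}|\nabla_X\Gamma^{\frac{1}{2-\beta}}|^2|u|^2\,d\nu\right)^2$$ $$+\frac14\int_{\Omega}\frac{|\nabla_X\Gamma^{\frac{1}{2-\beta}}|^2}{\Gamma^{\frac{2}{2-\beta}}}\left(\ln\frac{R}{\Gamma^{\frac{1}{2-\beta}}}\right)^{-2}|u|^2\,d\nu\int_{\Omega}\Gamma^{\frac{2}{2-\beta}}|\nabla_X\Gamma^{\frac{1}{2-\beta}}|^2|u|^2\,d\nu$$ $$+\frac{1}{2(\beta-2)}\int_{\partial\Omega}\Gamma^{-1}\left(\ln\frac{R}{\Gamma^{\frac{1}{2-\beta}}}\right)^{-1}|u|^2\langle\widetilde{\nabla}\Gamma,d\nu\rangle\int_{\Omega}\Gamma^{\frac{2}{2-\beta}}|\nabla_X\Gamma^{\frac{1}{2-\beta}}|^2|u|^2\,d\nu$$ $$+\frac12\int_{\partial\Omega}\Gamma^{-1}|u|^2\langle\widetilde{\nabla}\Gamma,d\nu\rangle\int_{\Omega}\Gamma^{\frac{2}{2-\beta}}|\nabla_X\Gamma^{\frac{1}{2-\beta}}|^2|u|^2\,d\nu,$$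 and also $$\int_{\Omega}\frac{\Gamma^{\frac{2}{2-\beta}}}{|\nabla_X\Gamma^{\frac{1}{2-\beta}}|^2}|u|^2\,d\nu\int_{\Omega}|\nabla_Xu|^2\,d\nu\ge\left(\frac{\beta-2}{2}\right)^2\left(\int_{\Omega}|u|^2\,d\nu\right)^2$$ $$+\frac14\int_{\Omega}\frac{|\nabla_X\Gamma^{\frac{1}{2-\beta}}|^2}{\Gamma^{\frac{2}{2-\beta}}}\left(\ln\frac{R}{\Gamma^{\frac{1}{2-\beta}}}\right)^{-2}|u|^2\,d\nu\int_{\Omega}\frac{\Gamma^{\frac{2}{2-\beta}}}{|\nabla_X\Gamma^{\frac{1}{2-\beta}}|^2}|u|^2\,d\nu$$ $$+\frac{1}{2(\beta-2)}\int_{\partial\Omega}\Gamma^{-1}\left(\ln\frac{R}{\Gamma^{\frac{1}{2-\beta}}}\right)^{-1}|u|^2\langle\widetilde{\nabla}\Gamma,d\nu\rangle\int_{\Omega}\frac{\Gamma^{\frac{2}{2-\beta}}}{|\nabla_X\Gamma^{\frac{1}{2-\beta}}|^2}|u|^2\,d\nu$$ $$+\frac12\int_{\partial\Omega}\Gamma^{-1}|u|^2\langle\widetilde{\nabla}\Gamma,d\nu\rangle\int_{\Omega}\frac{\Gamma^{\frac{2}{2-\beta}}}{|\nabla_X\Gamma^{\frac{1}{2-\beta}}|^2}|u|^2\,d\nu .$$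
   Context: Let $M$ be a smooth manifold of dimension $n$ with a volume form $d\nu$, let $\{X_k\}_{k=1}^{N}$, $N\le n$, be a family of real vector fields on $M$, and let $\mathcal{L}=\sum_{k=1}^{N}X_k^2$, $\nabla_X=(X_1,\ldots,X_N)$. The space $C^{2}$ is the space of functions with continuous second derivatives with respect to $\{X_k\}$, and $C^1$ is understood analogously with first derivatives. $\langle X_k,d\nu\rangle$ denotes the duality product (contraction) of the vector field $X_k$ with the $n$-form $d\nu$; it is an $(n-1)$-form. For a function $u$, $\widetilde{\nabla}u=\sum_{k=1}^{N}(X_ku)X_k$, so that $\langle\widetilde{\nabla}u,d\nu\rangle=\sum_{k=1}^N (X_ku)\langle X_k,d\nu\rangle$. Assumption $({\rm A}_y)$ for a point $y\in M$: there is an open set $T_y\subset M$ containing $y$ such that $-\mathcal{L}$ has a fundamental solution in $T_y$, i.e. there is a function $\Gamma_y\in C^2(T_y\setminus\{y\})$ with $-\mathcal{L}\Gamma_y=\delta_y$ in $T_y$, where $\delta_y$ is the Dirac distribution at $y$. Assumption $({\rm A}_y^+)$: $({\rm A}_y)$ holds and, moreover, $\Gamma_y(x)>0$ in $T_y\setminus\{y\}$ and $\frac{1}{\Gamma_y}(y)=0$. Admissible domain: an open bounded set $\Omega\subset M$ whose boundary $\partial\Omega$ has no self-intersections and such that $$\sum_{k=1}^{N}\int_{\Omega}X_kf_k\,d\nu=\sum_{k=1}^{N}\int_{\partial\Omega}f_k\langle X_k,d\nu\rangle$$ for all $f_k\in C^1(\Omega)\cap C(\overline{\Omega})$, $k=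1,\ldots,N$.
   Formalization: The closure of Ω is required to lie in T_y, so that Γ is defined on ∂Ω; in the second inequality the case where the integral of Γ^{2/(2-β)}|u|^2/|∇_XΓ^{1/(2-β)}|^2 is infinite and the integral of |∇_X u|^2 is zero (left side ∞·0) is excluded. *)

(* Defs.v *)
From HB Require Import structures.
From mathcomp Require Import all_boot all_order all_algebra.
From mathcomp Require Import complex.
From mathcomp Require Import all_classical all_reals all_analysis.

Set Implicit Arguments.
Unset Strict Implicit.
Unset Printing Implicit Defensive.

Import Order.TTheory GRing.Theory Num.Theory.
Import numFieldNormedType.Exports.

Local Open Scope classical_set_scope.
Local Open Scope ring_scope.

Section Euclidean.
Context {R : realType}.

Definition basis_vec n (a : 'I_n) : 'rV[R]_n := delta_mx ord0 a.

(* C^k on an open set: differentiable with C^(k-1) directional derivatives. *)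
Fixpoint Ck n (k : nat) (U : set 'rV[R]_n) (f : 'rV[R]_n -> R) : Prop :=
  match k with
  | 0 => forall z, U z -> {for z, continuous f}
  | k'.+1 => (forall z, U z -> differentiable f z) /\
             (forall v, Ck k' U ('D_v f))
  end.

Definition Cinfty n (U : set 'rV[R]_n) (f : 'rV[R]_n -> R) :=
  forall k, Ck k U f.

(* Lebesgue integral over R^n of a nonnegative function, as an iterated
   integral (Tonelli). *)
Fixpoint lebesgue_int n : ('rV[R]_n -> \bar R) -> \bar R :=
  match n with
  | 0 => fun f => f 0
  | n'.+1 => fun f =>
      (\int[@lebesgue_measure R]_s
         lebesgue_int (fun z : 'rV[R]_n' => f (row_mx (s%:M : 'rV[R]_1) z)))%E
  end.

Definition closed_cube n : set 'rV[R]_n :=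
  [set t | forall a, 0 <= t ord0 a <= 1].
Definition open_cube n : set 'rV[R]_n :=
  [set t | forall a, 0 < t ord0 a < 1].

(* Integral over [0,1]^n (used for continuous integrands only), again as an
   iterated integral; over [0,1]^0 it is the value at the unique point. *)
Fixpoint cube_int n : ('rV[R]_n -> R) -> R :=
  match n with
  | 0 => fun f => f 0
  | n'.+1 => fun f =>
      \int[@lebesgue_measure R]_(s in `[0, 1]%classic)
         cube_int (fun z : 'rV[R]_n' => f (row_mx (s%:M : 'rV[R]_1) z))
  end.

End Euclidean.

Notation borel M := (g_sigma_algebraType (@open M)).

(* Smooth manifold structure of dimension n on M, given by an atlas; [crd i]
   is the i-th coordinate map (meaningful on [dom i]) and [par i] its
   inverse (meaningful on [crd i @` dom i]). *)
Record manifold (R : realType) (n : nat) (M : ptopologicalType) := Manifold {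
  chart : Type;
  dom : chart -> set M;
  crd : chart -> M -> 'rV[R]_n;
  par : chart -> 'rV[R]_n -> M;
  chart_at : M -> chart;
  man_hausdorff : hausdorff_space M;
  man_second_countable : @second_countable M;
  chart_atP : forall x, dom (chart_at x) x;
  dom_open : forall i, open (dom i);
  img_open : forall i, open (crd i @` dom i);
  crdK : forall i x, dom i x -> par i (crd i x) = x;
  crd_continuous : forall i x, dom i x -> {for x, continuous (crd i)};
  par_continuous : forall i z, (crd i @` dom i) z -> {for z, continuous (par i)};
  transition_smooth : forall i j b,
    Cinfty (crd i @` (dom i `&` dom j)) (fun z => crd j (par i z) ord0 b)
}.

Section Manifold.
Context {R : realType} {n : nat} {M : ptopologicalType} (A : manifold R n M).
Local Notation chart := (chart A).

Definition smooth (f : M -> R) :=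
  forall i : chart, Cinfty (crd i @` dom i) (fun z => f (par i z)).

(* Jacobian of the change of coordinates from chart i to chart j, acting on
   row vectors from the right. *)
Definition transition_jac (i j : chart) (x : M) : 'M[R]_n :=
  \matrix_(a, b) 'D_(basis_vec a) (fun z => crd j (par i z) ord0 b) (crd i x).

(* Vector fields, given by their components in each chart. *)
Record vector_field := VectorField {
  comp :> chart -> M -> 'rV[R]_n;
  comp_change : forall i j x, dom i x -> dom j x ->
    comp j x = comp i x *m transition_jac i j x;
  comp_smooth : forall i b,
    Cinfty (crd i @` dom i) (fun z => comp i (par i z) ord0 b)
}.

(* Volume forms: in chart i the form is [density i] dx_1 /\ ... /\ dx_n. *)
Record volume_form := VolumeForm {
  density :> chart -> M -> R;
  density_change : forall i j x, dom i x -> dom j x ->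
    density i x = density j x * \det (transition_jac i j x);
  density_smooth : forall i,
    Cinfty (crd i @` dom i) (fun z => density i (par i z));
  density_neq0 : forall i x, dom i x -> density i x != 0
}.

(* nu is the Borel measure of integration against the volume form dnu, M
   being oriented by dnu. The open sets [dom i] cover the second countable
   space M, so this property determines nu. *)
Definition volume_measure (dnu : volume_form)
    (nu : {measure set (borel M) -> \bar R}) :=
  forall (i : chart) (B : set (borel M)), measurable B -> B `<=` dom i ->
    nu B = lebesgue_int
      (fun z => if z \in crd i @` B then `|dnu i (par i z)|%:E else 0%E).

Definition flow_line (X : vector_field) (x : M) (g : R -> M) :=
  g 0 = x /\ \forall s \near (0 : R), ({for s, continuous g} /\
    forall (i : chart), dom i (g s) -> forall b,
      is_derive s (1 : R) (fun r => crd i (g r) ord0 b) (X i (g s) ord0 b)).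

(* X f (x) = l, for f possibly not differentiable in the ordinary sense:
   derivative of f along the integral curve of X issued from x. The curve
   exists and its germ is unique, X being smooth. *)
Definition is_lie (X : vector_field) (f : M -> R) (x : M) (l : R) :=
  (exists g, flow_line X x g) /\
  (forall g, flow_line X x g -> is_derive (0 : R) (1 : R) (f \o g) l).

Definition lie (X : vector_field) (f : M -> R) (x : M) : R :=
  xget 0 [set l | is_lie X f x l].

Section Family.
Context {N : nat} (X : 'I_N -> vector_field).

(* C^1 and C^2 on an open set U, with respect to X_1, ..., X_N *)
Definition C1 (U : set M) (f : M -> R) :=
  (forall x, U x -> {for x, continuous f}) /\
  (forall k x, U x -> (exists l, is_lie (X k) f x l) /\
                      {for x, continuous (lie (X k) f)}).

Definition C2 (U : set M) (f : M -> R) :=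
  C1 U f /\ forall k, C1 U (lie (X k) f).

Definition sumsq (f : M -> R) (x : M) : R :=
  \sum_(k < N) lie (X k) (lie (X k) f) x.

Definition gradsq (f : M -> R) (x : M) : R :=
  \sum_(k < N) lie (X k) f x ^+ 2.

Definition grad_field (f : M -> R) (i : chart) (x : M) : 'rV[R]_n :=
  \sum_(k < N) lie (X k) f x *: X k i x.

Definition C1C (U : set M) (u : M -> R[i]) :=
  C1 U (@complex.Re R \o u) /\ C1 U (@complex.Im R \o u).

Definition sqmod (z : R[i]) : R := complex.Re z ^+ 2 + complex.Im z ^+ 2.

Definition gradsqC (u : M -> R[i]) (x : M) : R :=
  \sum_(k < N) sqmod (Complex (lie (X k) (@complex.Re R \o u) x)
                              (lie (X k) (@complex.Im R \o u) x)).

Definition support (f : M -> R) : set M := closure [set x | f x != 0].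

Definition test_function (U : set M) (f : M -> R) :=
  [/\ smooth f, compact (support f) & support f `<=` U].

Variable nu : {measure set (borel M) -> \bar R}.

(* h = L^t phi, where L^t is the formal transpose of L = sum_k X_k^2 with
   respect to nu. *)
Definition transpose_sumsq (phi h : M -> R) :=
  [/\ forall x, {for x, continuous h},
      forall x, ~ support phi x -> h x = 0 &
      forall psi, test_function setT psi ->
        (\int[nu]_(x in setT) (psi x * h x)) =
        (\int[nu]_(x in setT) (sumsq psi x * phi x))].

(* - L G = delta_y in T, in the sense of distributions *)
Definition solves_dirac (T : set M) (y : M) (G : M -> R) :=
  (forall K, compact K -> K `<=` T -> nu.-integrable K (EFin \o G)) /\
  (forall phi h, test_function T phi -> transpose_sumsq phi h ->
     - (\int[nu]_(x in T) (G x * h x)) = phi y).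

Definition assumption_A (T : set M) (y : M) (G : M -> R) :=
  [/\ open T, T y, C2 (T `\ y) G & solves_dirac T y G].

Definition assumption_Aplus (T : set M) (y : M) (G : M -> R) :=
  [/\ assumption_A T y G,
      forall x, (T `\ y) x -> 0 < G x &
      (G x)^-1 @[x --> y^'] --> (0 : R)].

End Family.
End Manifold.

Section Boundary.
Context {R : realType} {m : nat} {M : ptopologicalType}
  (A : manifold R m.+1 M).

Definition boundary (Om : set M) : set M := closure Om `\` interior Om.

(* The boundary is a topological hypersurface. *)
Definition no_self_intersection (Om : set M) :=
  forall x, boundary Om x ->
    exists (V : set M) (g : M -> 'rV[R]_m) (h : 'rV[R]_m -> M),
      [/\ open V /\ V x,
          forall z, (V `&` boundary Om) z -> h (g z) = z,
          forall t, (V `&` boundary Om) (h t) /\ g (h t) = t,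
          {within V `&` boundary Om, continuous g} &
          continuous h].

(* Rows: coordinates, in the preferred chart at sigma(t), of the partial
   derivatives of the patch sigma. *)
Definition tangent (sigma : 'rV[R]_m -> M) (t : 'rV[R]_m) : 'M[R]_(m, m.+1) :=
  \matrix_(a, b)
    'D_(basis_vec a) (fun r => crd (chart_at A (sigma t)) (sigma r) ord0 b) t.

(* <v, dnu>(d_1 sigma, ..., d_m sigma) at sigma(t), i.e. the coefficient of
   the pull-back by sigma of the contraction of v with dnu *)
Definition contraction (dnu : volume_form A) (sigma : 'rV[R]_m -> M)
    (t : 'rV[R]_m) (v : 'rV[R]_m.+1) : R :=
  dnu (chart_at A (sigma t)) (sigma t) *
  \det (col_mx v (tangent sigma t) : 'M[R]_m.+1).

(* v (in the preferred chart at x) points out of Om. *)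
Definition outward (Om : set M) (x : M) (v : 'rV[R]_m.+1) :=
  let i := chart_at A x in
  \forall s \near 0^'+, (~ Om (par i (crd i x + s *: v)) /\
                         Om (par i (crd i x - s *: v))).

(* Presentation of the boundary as an oriented piecewise C^1 hypersurface:
   finitely many C^1 cubes, non-overlapping up to their faces. The signs
   [flip] realise the boundary orientation (outward vector first); they are
   needed for m = 0, when the boundary is a finite set of signed points. *)
Record boundary_patches (dnu : volume_form A) (Om : set M) := BoundaryPatches {
  pieces : nat;
  patch : 'I_pieces -> 'rV[R]_m -> M;
  flip : 'I_pieces -> bool;
  patch_C1 : forall p, exists V : set 'rV[R]_m,
    [/\ open V, closed_cube (n:=m) `<=` V,
        forall t, V t -> {for t, continuous (patch p)} &
        forall (i : chart A) b,
          Ck 1 (V `&` patch p @^-1` dom i) (fun t => crd i (patch p t) ord0 b)];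
  patch_immersion : forall p t, open_cube (n:=m) t ->
    row_free (tangent (patch p) t);
  patch_inj : forall p q s t, open_cube (n:=m) s -> open_cube (n:=m) t ->
    patch p s = patch q t -> p = q /\ s = t;
  patch_cover : \bigcup_p (patch p @` closed_cube (n:=m)) = boundary Om;
  patch_orientation : forall p t v, open_cube (n:=m) t ->
    outward Om (patch p t) v ->
    0 <= (-1) ^+ flip p * contraction dnu (patch p) t v
}.

(* Integral over the boundary of the m-form f <Y, dnu>, for a vector field
   with components Y in each chart *)
Definition boundary_int (dnu : volume_form A) (Om : set M)
    (P : boundary_patches dnu Om) (f : M -> R)
    (Y : chart A -> M -> 'rV[R]_m.+1) : R :=
  \sum_(p < pieces P) (-1) ^+ flip p *
    cube_int (fun t => let x := patch p t in
      f x * contraction dnu (patch p) t (Y (chart_at A x) x)).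

(* "Bounded" means relatively compact. In the divergence formula the
   functions f_k range over those for which the left-hand side converges. *)
Definition admissible_domain {N : nat} (X : 'I_N -> vector_field A)
    (dnu : volume_form A) (nu : {measure set (borel M) -> \bar R})
    (Om : set M) (P : boundary_patches dnu Om) :=
  [/\ open Om, compact (closure Om), no_self_intersection Om &
    forall f : 'I_N -> M -> R,
      (forall k, C1 X Om (f k)) ->
      (forall k, {within closure Om, continuous (f k)}) ->
      (forall k, nu.-integrable Om (EFin \o lie (X k) (f k))) ->
      \sum_(k < N) (\int[nu]_(x in Om) lie (X k) (f k) x) =
      \sum_(k < N) boundary_int P (f k) (X k)].

End Boundary.

(* Main.v *)
(** Applied to compactly supported functions, the divergence formula of the
    admissible domain says that each X_k is divergence free on Omega. Hence the
    formal transpose of L is L itself there, and -L Gamma = delta_y gives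
    L Gamma = 0 pointwise on Omega \ {y}.

    With d = Gamma^(1 / (2 - beta)), l = ln (R / d) and phi = (Gamma l)^(1/2),
    one computes on Omega \ {y}
      - L phi / phi = ((beta - 2) / 2)^2 |grad d|^2 / d^2
                      + |grad d|^2 / (4 d^2 l^2),
    and |grad u|^2 >= div (|u|^2 grad phi / phi) - (L phi / phi) |u|^2 because
    the difference is |grad u - u grad phi / phi|^2. To integrate, the field is
    multiplied by a cutoff chi_n (Gamma) vanishing near y; since chi_n is
    nonincreasing and grad phi / phi is a nonnegative multiple of grad Gamma,
    the derivative of the cutoff contributes with the favourable sign, so
    monotone convergence yields the logarithmic Hardy inequality with boundary
    terms. Both inequalities follow by multiplying it by the weight integral
    and using the Cauchy-Schwarz inequality. *)

Require Import Defs.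
From mathcomp Require Import all_boot all_order all_algebra.
From mathcomp Require Import complex ring lra finmap.
From mathcomp Require Import all_classical all_reals all_analysis measurable_realfun.

Set Implicit Arguments.
Unset Strict Implicit.
Unset Printing Implicit Defensive.

Import Order.TTheory GRing.Theory Num.Theory.
Import numFieldNormedType.Exports.

Local Open Scope classical_set_scope.
Local Open Scope ring_scope.

(** * Smooth step functions *)

Section SmoothCutoff.
Context {R : realType}.
Implicit Types (p : {poly R}) (t h : R).

Definition expV p t : R := if t <= 0 then 0 else p.[t^-1] * expR (- t^-1).

Lemma expV_pos p t : 0 < t -> expV p t = p.[t^-1] * expR (- t^-1).
Proof. by move=> t0; rewrite /expV; case: leP t0. Qed.

Lemma expV_neg p t : t <= 0 -> expV p t = 0.
Proof. by rewrite /expV => ->. Qed.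

Lemma expV_bound p : exists2 C : R, 0 <= C & forall t, 0 < t -> `|expV p t| <= C * t.
Proof.
exists (\sum_(i < size p) `|p`_i| * i.+1`!%:R).
  by apply: sumr_ge0 => i _; rewrite mulr_ge0.
move=> t t0; rewrite expV_pos// horner_coef mulr_suml mulr_suml.
rewrite (le_trans (ler_norm_sum _ _ _))//; apply: ler_sum => i _.
rewrite !normrM -!mulrA ler_wpM2l//.
rewrite (gtr0_norm (expR_gt0 _)) (@ger0_norm _ (_ ^+ _)); last by rewrite exprn_ge0// invr_ge0 ltW.
have tn0 : t != 0 by rewrite gt_eqF.
have := @expR_ge1Dxn R t^-1 i; rewrite invr_ge0 (ltW t0) => /(_ isT) le1.
have {le1} : t^-1 ^+ i.+1 / i.+1`!%:R <= expR t^-1.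
  by apply: le_trans le1; rewrite lerDr.
rewrite ler_pdivrMr ?ltr0n ?fact_gt0// => le1.
rewrite expRN ler_pdivrMr ?expR_gt0// mulrAC mulrC -ler_pdivrMl//.
by rewrite -exprS mulrC.
Qed.

Lemma is_derive_expV p t :
  is_derive t (1 : R) (expV p) (expV ('X^2 * (p - p^`())) t).
Proof.
have [t0|t0|->] := ltgtP t 0.
- rewrite (expV_neg _ (ltW t0)).
  apply: (@near_eq_is_derive _ _ _ (cst 0)).
  near=> s; rewrite expV_neg//; apply: ltW.
  by near: s; apply: lt_nbhsl.
- rewrite (expV_pos _ t0).
  have key : \forall s \near t, p.[s^-1] * expR (- s^-1) = expV p s.
    near=> s; rewrite expV_pos//.
    by near: s; apply: lt_nbhsr.
  have tn0 : t != 0 by rewrite gt_eqF.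
  have dV : is_derive t (1 : R) (fun s : R => s^-1) (- t ^- 2).
    by apply: (is_derive_eq (@is_deriveV _ id t 1 1 tn0 _)); rewrite [_ *: _]mulr1.
  have d1 := is_derive1_comp (is_derive_poly p t^-1) dV.
  have d2 : is_derive t (1 : R) (expR \o (fun s => - s^-1)) (expR (- t^-1) * t ^- 2).
    by apply: is_derive1_comp; apply: (is_derive_eq (is_deriveN dV)); rewrite opprK.
  have d3 := is_deriveM d1 d2.
  apply: (near_eq_is_derive key); apply: (is_derive_eq d3).
  rewrite /= hornerM hornerXn hornerD hornerN /GRing.scale/= exprVn derivE.
  by ring.
- have [C C0 hC] := expV_bound ('X * p).
  have e0 : expV ('X^2 * (p - p^`())) 0 = 0 by rewrite expV_neg.
  have lim0 : h^-1 *: (expV p (h *: (1:R) + 0) - expV p 0) @[h --> 0^'] --> (0:R).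
    apply/cvgrPdist_le => /= e ep; near=> h.
    rewrite sub0r normrN addr0 [expV p 0]expV_neg// subr0 /GRing.scale/= mulr1.
    have hn0 : h != 0 by near: h; exact: nbhs_dnbhs_neq.
    have [h0|h0] := leP h 0; first by rewrite expV_neg// mulr0 normr0 ltW.
    have -> : h^-1 * expV p h = expV ('X * p) h.
      by rewrite !expV_pos// hornerM hornerX mulrA.
    rewrite (le_trans (hC _ h0))//.
    have : `|h| <= e / (C + 1).
      near: h; apply: dnbhs0_le; rewrite divr_gt0// ltr_wpDl//.
    rewrite gtr0_norm// ler_pdivlMr ?ltr_wpDl// => /(le_trans _); apply.
    by rewrite mulrC ler_wpM2l ?lerDl// ltW.
  apply: DeriveDef; first by apply/cvg_ex; exists 0.
  by rewrite e0; apply/cvg_lim.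
Unshelve. all: by end_near. Qed.

Lemma expV_ge0 t : 0 <= expV 1 t.
Proof. by rewrite /expV; case: ifP => // _; rewrite hornerC mul1r expR_ge0. Qed.

Lemma expV_gt0 t : (0 < expV 1 t) = (0 < t).
Proof.
by rewrite /expV; case: (leP t 0) => t0; rewrite ?ltxx// hornerC mul1r expR_gt0.
Qed.

Definition smooth1 (f : R -> R) := exists D : nat -> R -> R,
  D 0%N = f /\ forall n t, is_derive t (1 : R) (D n) (D n.+1 t).

Lemma smooth1_expV p : smooth1 (expV p).
Proof.
exists (fun n => expV (iter n (fun q : {poly R} => 'X^2 * (q - q^`())) p)).
by split => // n t; exact: is_derive_expV.
Qed.

Definition step t := expV 1 t / (expV 1 t + expV 1 (1 - t)).

Let den_gt0 t : 0 < expV 1 t + expV 1 (1 - t).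
Proof.
have [t0|t0] := ltP 0 t; first by rewrite ltr_pwDl ?expV_ge0// expV_gt0.
by rewrite ltr_wpDl ?expV_ge0// expV_gt0 subr_gt0 (le_lt_trans t0).
Qed.

Lemma step0 t : t <= 0 -> step t = 0.
Proof. by move=> t0; rewrite /step {1}/expV t0 mul0r. Qed.

Lemma step1 t : 1 <= t -> step t = 1.
Proof.
move=> t1; rewrite /step.
have -> : expV 1 (1 - t) = 0 by rewrite /expV subr_le0 t1.
by rewrite addr0 divff// gt_eqF// expV_gt0 (lt_le_trans ltr01).
Qed.

Lemma step_ge0 t : 0 <= step t.
Proof. by rewrite divr_ge0 ?expV_ge0// ltW. Qed.

Lemma step_le1 t : step t <= 1.
Proof. by rewrite /step ler_pdivrMr// mul1r lerDl expV_ge0. Qed.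

Definition step' t :=
  (expV 'X^2 t * expV 1 (1 - t) + expV 1 t * expV 'X^2 (1 - t))
  / (expV 1 t + expV 1 (1 - t)) ^+ 2.

Let derexpV1 t : is_derive t (1 : R) (expV 1) (expV 'X^2 t).
Proof.
have := is_derive_expV 1 t.
by rewrite derivC subr0 mulr1.
Qed.

Lemma is_derive_step t : is_derive t (1 : R) step (step' t).
Proof.
have d0 := derexpV1 t.
have d1 : is_derive t (1 : R) (expV 1 \o (fun s => 1 - s)) (- expV 'X^2 (1 - t)).
  rewrite -mulrN1; apply: is_derive1_comp.
    exact: derexpV1.
  by apply: (is_derive_eq (is_deriveB (is_derive_cst (1:R) t (1:R)) (is_derive_id t (1:R)))); rewrite sub0r.
have d2 := is_deriveD d0 d1.
have nz : (expV 1 + (expV 1 \o (fun s => 1 - s))) t != 0 by rewrite gt_eqF//; exact: den_gt0.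
have d3 := is_deriveV nz d2.
have d4 := is_deriveM d0 d3.
apply: (is_derive_eq d4).
rewrite /step' /GRing.scale/= -[(_ + _) t]/(expV 1 t + expV 1 (1 - t)).
have nz' : expV 1 t + expV 1 (1 - t) != 0 by rewrite gt_eqF ?den_gt0.
by field.
Qed.

Lemma expV_ge0n t n : 0 <= expV 'X^n t.
Proof.
rewrite /expV; case: (leP t 0) => t0 //.
by rewrite hornerXn mulr_ge0 ?expR_ge0// exprn_ge0// invr_ge0 ltW.
Qed.

Lemma step'_ge0 t : 0 <= step' t.
Proof.
by rewrite divr_ge0 ?sqr_ge0// addr_ge0// mulr_ge0 ?expV_ge0 ?expV_ge0n.
Qed.

Lemma continuous_expV p : continuous (expV p).
Proof.
by move=> t; apply/differentiable_continuous/derivable1_diffP; have := is_derive_expV p t; case.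
Qed.

Lemma continuous_step' : continuous step'.
Proof.
have c1 p : continuous (fun t => expV p (1 - t)).
  move=> t; apply: (@continuous_comp _ _ _ (fun t => 1 - t) (expV p)).
    by apply: cvgB; [exact: cvg_cst|exact: cvg_id].
  exact: continuous_expV.
move=> t; apply: cvgM.
  by apply: cvgD; apply: cvgM; try exact: continuous_expV; exact: c1.
apply: cvgV; first by rewrite expf_eq0/= gt_eqF// den_gt0.
apply: (@continuous_comp _ _ _ (fun t => expV 1 t + expV 1 (1 - t)) (fun s => s ^+ 2)).
  by apply: cvgD; [exact: continuous_expV|exact: c1].
exact: exprn_continuous.
Qed.

Lemma step_nd : {homo step : x y / x <= y}.
Proof.
move=> x y xy; apply: (@ger0_derive1_ndecr _ step (x - 1) (y + 1)) => //.
- by move=> z _; have [] := is_derive_step z.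
- by move=> z _; rewrite derive1E (@derive_val _ _ _ _ _ _ _ (is_derive_step z)) step'_ge0.
- apply: continuous_subspaceT => z; apply/differentiable_continuous/derivable1_diffP.
  by have [] := is_derive_step z.
- by rewrite lerBlDr lerDl.
- by rewrite lerDl.
Qed.
End SmoothCutoff.

(** * Calculus of Ck functions *)

Section CkCalculus.
Context {R : realType} {n : nat}.
Implicit Types (U V : set 'rV[R]_n) (f g : 'rV[R]_n -> R).

Lemma open_near_eq (T : topologicalType) (Y : Type) (U : set T) (f g : T -> Y) z :
  open U -> (forall x, U x -> f x = g x) -> U z -> \near z, f z = g z.
Proof.
move=> oU fg Uz.
by apply: filterS (open_nbhs_nbhs (conj oU Uz)) => x; exact: fg.
Qed.

Lemma near_eq_for_continuous (T : topologicalType) (Y : topologicalType) (f g : T -> Y) z :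
  (\near z, f z = g z) -> {for z, continuous f} -> {for z, continuous g}.
Proof.
move=> fg cf; rewrite /prop_for /continuous_at -(nbhs_singleton fg).
exact: cvg_trans (near_eq_cvg fg) cf.
Qed.

Lemma near_eq_differentiable (V W : normedModType R) (f g : V -> W) z :
  (\near z, f z = g z) -> differentiable f z -> differentiable g z.
Proof.
move=> fg df.
pose e := fun x => g x - f x.
suff de : differentiable e z.
  have -> : g = f + e by apply/funext => x; rewrite /e fctE addrC subrK.
  exact: differentiableD.
have e0 : \near z, e z = 0 by apply: filterS fg => x fgx; rewrite /e fgx subrr.
have E : e \o shift z = cst (e z) + (\0 : {linear V -> W}) +o_ 0 id.
  apply/eqaddoP => _/posnumP[eps].
  have : \forall x \near (0 : V), e (x + z) = 0.
    by move: e0; rewrite (near_shift 0) subr0.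
  apply: filterS => x ex /=.
  by rewrite /= !fctE/= ex (nbhs_singleton e0) addr0 subrr normr0 mulr_ge0.
have cdf : continuous (\0 : {linear V -> W}) by move=> x; exact: cvg_cst.
apply/diff_locallyP; have -> := diff_unique cdf E.
by split.
Qed.

Lemma Ck_eq k U f g : open U -> (forall z, U z -> f z = g z) ->
  Ck k U f -> Ck k U g.
Proof.
move=> oU; elim: k f g => [|k IH] f g fg /=.
  by move=> cf z Uz; apply: near_eq_for_continuous (cf z Uz); exact: open_near_eq fg Uz.
move=> [df Df]; split.
  by move=> z Uz; apply: near_eq_differentiable (df z Uz); exact: open_near_eq fg Uz.
move=> v; apply: IH (Df v) => z Uz; apply: near_eq_derive.
exact: open_near_eq fg Uz.
Qed.

Lemma CkW k U f : Ck k.+1 U f -> Ck k U f.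
Proof.
elim: k f => [|k IH] f.
  by move=> [df _] z Uz; exact: differentiable_continuous (df z Uz).
by move=> [df Df]; split => // v; exact: IH (Df v).
Qed.

Lemma Ck_sub k U V f : V `<=` U -> Ck k U f -> Ck k V f.
Proof.
move=> VU; elim: k f => [|k IH] f /= h; first by move=> z /VU; exact: h.
by case: h => df Df; split => [z /VU|v]; [exact: df|exact: IH (Df v)].
Qed.

Lemma Ck_local k U f : (forall z, U z -> exists V, V z /\ Ck k V f) -> Ck k U f.
Proof.
elim: k f => [|k IH] f h /=.
  by move=> z /h[V [Vz]]; exact.
split=> [z /h[V [Vz [+ _]]]|v]; first exact.
by apply: IH => z /h[V [Vz [_ Df]]]; exists V; split => //; exact: Df.
Qed.

Lemma Ck_cst k U (c : R) : Ck k U (cst c).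
Proof.
elim: k c => [|k IH] c /=; first by move=> z _; exact: cst_continuous.
split=> [z _|v]; first exact: differentiable_cst.
by rewrite (_ : 'D_v _ = cst 0)//; apply/funext => z; rewrite derive_cst.
Qed.

Lemma Ck_D k U f g : open U -> Ck k U f -> Ck k U g -> Ck k U (f \+ g).
Proof.
move=> oU; elim: k f g => [|k IH] f g.
  by move=> /= cf cg z Uz; exact: (cvgD (cf z Uz) (cg z Uz)).
move=> [df Df] [dg Dg]; split=> [z Uz|v].
  by apply: differentiableD; [exact: df|exact: dg].
apply: (@Ck_eq _ _ ('D_v f \+ 'D_v g)) => //; last exact: IH (Df v) (Dg v).
move=> z Uz; rewrite /= deriveD//; apply: diff_derivable; [exact: df|exact: dg].
Qed.

Lemma Ck_M k U f g : open U -> Ck k U f -> Ck k U g -> Ck k U (f \* g).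
Proof.
move=> oU; elim: k f g => [|k IH] f g.
  by move=> /= cf cg z Uz; exact: (cvgM (cf z Uz) (cg z Uz)).
move=> Cf Cg; have [df Df] := Cf; have [dg Dg] := Cg; split=> [z Uz|v].
  by apply: differentiableM; [exact: df|exact: dg].
apply: (@Ck_eq _ _ ((f \* 'D_v g) \+ (g \* 'D_v f))) => //.
  by move=> z Uz; rewrite /= deriveM//; apply: diff_derivable; [exact: df|exact: dg].
by apply: Ck_D => //; apply: IH; [exact: CkW|exact: Dg|exact: CkW|exact: Df].
Qed.

Lemma Ck_sum k U (I : Type) (r : seq I) (F : I -> 'rV[R]_n -> R) : open U ->
  (forall i, Ck k U (F i)) -> Ck k U (fun z => \sum_(i <- r) F i z).
Proof.
move=> oU CF; elim: r => [|i r IH].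
  by rewrite (_ : (fun _ => _) = cst 0); [exact: Ck_cst|apply/funext => z; rewrite big_nil].
rewrite (_ : (fun _ => _) = F i \+ (fun z => \sum_(j <- r) F j z)); first exact: Ck_D.
by apply/funext => z; rewrite big_cons.
Qed.

Lemma is_derive_comp1 (V : normedModType R) (f : R -> R) (g : V -> R) z v a :
  is_derive (g z) (1 : R) f a -> differentiable g z ->
  differentiable (f \o g) z /\ 'D_v (f \o g) z = a * 'D_v g z.
Proof.
move=> [/derivable1_diffP df <-] dg.
have dfg : differentiable (f \o g) z by exact: differentiable_comp.
split => //; rewrite !deriveE// diff_comp//=.
by rewrite -[X in 'd f _ X]mulr1 [LHS]linearZ/= mulrC.
Qed.

Lemma Ck_comp k U (f : R -> R) g : open U -> smooth1 f -> Ck k U g -> Ck k U (f \o g).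
Proof.
move=> oU sf; elim: k f g sf => [|k IH] f g [D [D0 DS]] Cg.
  move=> z Uz; apply: continuous_comp; first exact: Cg.
  apply/differentiable_continuous/derivable1_diffP.
  by have := DS 0%N (g z); rewrite D0; case.
have [dg Dg] := Cg.
have dfg z v : U z -> differentiable (f \o g) z /\ 'D_v (f \o g) z = D 1%N (g z) * 'D_v g z.
  by move=> Uz; apply: is_derive_comp1 (dg z Uz); rewrite -D0; exact: DS.
split=> [z Uz|v]; first by have [] := dfg z 0 Uz.
apply: (@Ck_eq _ _ ((D 1%N \o g) \* 'D_v g)) => //.
  by move=> z /(dfg z v)[].
apply: Ck_M; [by []| |exact: Dg]; apply: IH; last exact: CkW.
by exists (fun n => D n.+1).
Qed.

Lemma Cinfty_derive U f v : Cinfty U f -> Cinfty U ('D_v f).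
Proof. by move=> Cf k; have [_] := Cf k.+1; exact. Qed.

Lemma Cinfty_differentiable U f z : Cinfty U f -> U z -> differentiable f z.
Proof. by move=> Cf; have [+ _] := Cf 1%N; exact. Qed.

Lemma Cinfty_continuous U f z : Cinfty U f -> U z -> {for z, continuous f}.
Proof. by move=> Cf; exact: (Cf 0%N). Qed.

Lemma derive_rowE f z v : differentiable f z ->
  'D_v f z = \sum_(b < n) v ord0 b * 'D_(basis_vec b) f z.
Proof.
move=> df; rewrite deriveE// {1}[v]row_sum_delta linear_sum; apply: eq_bigr => b _.
by rewrite linearZ deriveE.
Qed.
End CkCalculus.

(** * Derivatives along vector fields *)

Section LieDerivative.
Context {R : realType} {n : nat} {M : ptopologicalType} {A : manifold R n M}.
Implicit Types (X : vector_field A) (f g : M -> R) (U V : set M).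

Lemma flow_line_cvg X x c : flow_line X x c -> c @ (0 : R) --> x.
Proof. by case=> c0 /nbhs_singleton[+ _]; rewrite /prop_for /continuous_at c0. Qed.

Lemma flow_line_near X x c (P : set M) : flow_line X x c -> nbhs x P ->
  \forall s \near (0 : R), P (c s).
Proof. by move=> /flow_line_cvg; exact. Qed.

Lemma is_lie_unique X f x l l' : is_lie X f x l -> is_lie X f x l' -> l = l'.
Proof.
by move=> [[c cX] fl] [_ fl']; have [_ <-] := fl c cX; have [_ <-] := fl' c cX.
Qed.

Lemma lieE X f x l : is_lie X f x l -> lie X f x = l.
Proof.
move=> fl; rewrite /lie; case: xgetP => [y _ fy|/(_ l)//].
exact: is_lie_unique fy fl.
Qed.

Lemma lieP X f x : (exists l, is_lie X f x l) -> is_lie X f x (lie X f x).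
Proof. by move=> [l fl]; rewrite (lieE fl). Qed.

Lemma is_lie_near X f g x l : (\near x, f x = g x) -> is_lie X f x l -> is_lie X g x l.
Proof.
move=> fg [ec fl]; split=> // c cX.
by apply: near_eq_is_derive (fl c cX); exact: flow_line_near cX fg.
Qed.

Lemma lie_near X f g x : (\near x, f x = g x) -> lie X f x = lie X g x.
Proof.
move=> fg; rewrite /lie; congr xget; apply/seteqP; split => l /=; apply: is_lie_near => //.
by apply: filterS fg.
Qed.

Lemma is_lie_cst X x (a : R) : (exists c, flow_line X x c) -> is_lie X (cst a) x 0.
Proof. by move=> ec; split => // c _; exact: is_derive_cst. Qed.

Lemma lie_eq0 X f x : (\near x, f x = 0) -> lie X f x = 0.
Proof.
move=> f0; rewrite (@lie_near _ _ (cst 0))//.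
have [ec|nec] := pselect (exists c, flow_line X x c).
  by rewrite (lieE (is_lie_cst _ ec)).
by rewrite /lie; case: xgetP => // l _ [].
Qed.

Lemma is_lieD X f g x a b : is_lie X f x a -> is_lie X g x b ->
  is_lie X (f \+ g) x (a + b).
Proof. by move=> [ec fa] [_ gb]; split=> // c cX; exact: is_deriveD (fa c cX) (gb c cX). Qed.

Lemma is_lieM X f g x a b : is_lie X f x a -> is_lie X g x b ->
  is_lie X (f \* g) x (f x * b + g x * a).
Proof.
move=> [ec fa] [_ gb]; split=> // c cX; have [c0 _] := cX.
by rewrite -c0; exact: is_deriveM (fa c cX) (gb c cX).
Qed.

Lemma is_lie_comp X (F : R -> R) f x a b : is_derive (f x) (1 : R) F a ->
  is_lie X f x b -> is_lie X (F \o f) x (a * b).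
Proof.
move=> Fa [ec fb]; split=> // c cX; have [c0 _] := cX.
by apply: (is_derive1_comp _ (fb c cX)); rewrite /= c0.
Qed.

Section C1calculus.
Context {N : nat} {X : 'I_N -> vector_field A}.

Definition flows U := forall k x, U x -> exists c, flow_line (X k) x c.

Lemma C1_flows U f : C1 X U f -> flows U.
Proof. by move=> [_ fU] k x /(fU k)[[l []]]. Qed.

Lemma C1_lieP U f k x : C1 X U f -> U x -> is_lie (X k) f x (lie (X k) f x).
Proof. by move=> [_ fU] /(fU k)[/lieP]. Qed.

Lemma C1_continuous U f x : C1 X U f -> U x -> {for x, continuous f}.
Proof. by case=> + _; exact. Qed.

Lemma C1_lie_continuous U f k x : C1 X U f -> U x -> {for x, continuous (lie (X k) f)}.
Proof. by move=> [_ h] /(h k)[]. Qed.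

Lemma C1_sub U V f : V `<=` U -> C1 X U f -> C1 X V f.
Proof. by move=> VU [cf df]; split=> [x /VU|k x /VU]; [exact: cf|exact: df]. Qed.

Lemma C1_setU U V f : C1 X U f -> C1 X V f -> C1 X (U `|` V) f.
Proof.
by move=> [a b] [c d]; split=> [x|k x] [h|h]; [exact: a|exact: c|exact: b|exact: d].
Qed.

Lemma C1_intro U f (l : 'I_N -> M -> R) : open U ->
  (forall x, U x -> {for x, continuous f}) ->
  (forall k x, U x -> is_lie (X k) f x (l k x)) ->
  (forall k x, U x -> {for x, continuous (l k)}) -> C1 X U f.
Proof.
move=> oU cf fl cl; split => // k x Ux; split; first by exists (l k x); exact: fl.
apply: near_eq_for_continuous (cl k x Ux); apply: open_near_eq Ux => // z Uz.
by rewrite (lieE (fl k z Uz)).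
Qed.

Lemma C1_eq U f g : open U -> (forall x, U x -> f x = g x) -> C1 X U f -> C1 X U g.
Proof.
move=> oU fg Cf; have nfg x : U x -> \near x, f x = g x by exact: open_near_eq.
apply: (@C1_intro _ _ (fun k => lie (X k) f)) => //.
- by move=> x Ux; apply: near_eq_for_continuous (C1_continuous Cf Ux); exact: nfg.
- by move=> k x Ux; apply: is_lie_near (C1_lieP k Cf Ux); exact: nfg.
- by move=> k x Ux; exact: C1_lie_continuous Cf Ux.
Qed.

Lemma C1_cst U (a : R) : open U -> flows U -> C1 X U (cst a).
Proof.
move=> oU fU; apply: (@C1_intro _ _ (fun _ => cst 0)) => //.
- by move=> x _; exact: cst_continuous.
- by move=> k x Ux; apply: is_lie_cst; exact: fU.
- by move=> k x _; exact: cst_continuous.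
Qed.

Lemma C1_D U f g : open U -> C1 X U f -> C1 X U g -> C1 X U (f \+ g).
Proof.
move=> oU Cf Cg; apply: (@C1_intro _ _ (fun k => lie (X k) f \+ lie (X k) g)) => //.
- by move=> x Ux; exact: (cvgD (C1_continuous Cf Ux) (C1_continuous Cg Ux)).
- by move=> k x Ux; exact: (is_lieD (C1_lieP k Cf Ux) (C1_lieP k Cg Ux)).
- by move=> k x Ux; exact: (cvgD (C1_lie_continuous Cf Ux) (C1_lie_continuous Cg Ux)).
Qed.

Lemma C1_M U f g : open U -> C1 X U f -> C1 X U g -> C1 X U (f \* g).
Proof.
move=> oU Cf Cg.
apply: (@C1_intro _ _ (fun k => (f \* lie (X k) g) \+ (g \* lie (X k) f))) => //.
- by move=> x Ux; exact: (cvgM (C1_continuous Cf Ux) (C1_continuous Cg Ux)).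
- by move=> k x Ux; exact: (is_lieM (C1_lieP k Cf Ux) (C1_lieP k Cg Ux)).
- move=> k x Ux; apply: cvgD.
    exact: (cvgM (C1_continuous Cf Ux) (C1_lie_continuous Cg Ux)).
  exact: (cvgM (C1_continuous Cg Ux) (C1_lie_continuous Cf Ux)).
Qed.

Lemma lie_M U f g k x : C1 X U f -> C1 X U g -> U x ->
  lie (X k) (f \* g) x = f x * lie (X k) g x + g x * lie (X k) f x.
Proof. by move=> Cf Cg Ux; exact: lieE (is_lieM (C1_lieP k Cf Ux) (C1_lieP k Cg Ux)). Qed.

Lemma lie_D U f g k x : C1 X U f -> C1 X U g -> U x ->
  lie (X k) (f \+ g) x = lie (X k) f x + lie (X k) g x.
Proof. by move=> Cf Cg Ux; exact: lieE (is_lieD (C1_lieP k Cf Ux) (C1_lieP k Cg Ux)). Qed.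

Lemma C1_comp U (F F' : R -> R) f : open U -> C1 X U f ->
  (forall x, U x -> is_derive (f x) (1 : R) F (F' (f x))) ->
  (forall x, U x -> {for f x, continuous F'}) -> C1 X U (F \o f).
Proof.
move=> oU Cf dF cF.
apply: (@C1_intro _ _ (fun k => (F' \o f) \* lie (X k) f)) => //.
- move=> x Ux; apply: continuous_comp; first exact: C1_continuous Cf Ux.
  by apply/differentiable_continuous/derivable1_diffP; case: (dF x Ux).
- by move=> k x Ux; exact: (is_lie_comp (dF x Ux) (C1_lieP k Cf Ux)).
- move=> k x Ux; apply: (cvgM _ (C1_lie_continuous Cf Ux)).
  by apply: continuous_comp; [exact: C1_continuous Cf Ux|exact: cF].
Qed.

Lemma lie_comp U (F F' : R -> R) f k x : C1 X U f -> U x ->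
  is_derive (f x) (1 : R) F (F' (f x)) ->
  lie (X k) (F \o f) x = F' (f x) * lie (X k) f x.
Proof. by move=> Cf Ux dF; exact: lieE (is_lie_comp dF (C1_lieP k Cf Ux)). Qed.

End C1calculus.
End LieDerivative.
Arguments flows {R n M A N} X U.

Section SmoothFunctions.
Context {R : realType} {n : nat} {M : ptopologicalType} {A : manifold R n M}.
Implicit Types (f g : M -> R) (U V : set M).
Local Notation dom := (@dom _ _ _ A).
Local Notation crd := (@crd _ _ _ A).
Local Notation par := (@par _ _ _ A).

Lemma crd_imgP i U z : (crd i @` (dom i `&` U)) z <-> (crd i @` dom i) z /\ U (par i z).
Proof.
split=> [[x [dx Ux] <-]|[[x dx <-]]]; first by rewrite crdK//; split => //; exists x.
by rewrite crdK// => Ux; exists x.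
Qed.

Lemma open_crd_img i U : open U -> open (crd i @` (dom i `&` U)).
Proof.
move=> oU; rewrite openE => z /crd_imgP[dz Uz].
have n1 : nbhs z (crd i @` dom i) by apply: open_nbhs_nbhs; split => //; exact: img_open.
have n2 : nbhs z (par i @^-1` U).
  by apply: (par_continuous dz); exact: open_nbhs_nbhs.
by apply: filterS2 n1 n2 => w dw Uw; apply/crd_imgP.
Qed.

Lemma dom_nbhs i x : dom i x -> nbhs x (dom i).
Proof. by move=> dx; apply: open_nbhs_nbhs; split => //; exact: dom_open. Qed.

Definition smooth_on U f := forall i, Cinfty (crd i @` (dom i `&` U)) (f \o par i).

Lemma smooth_on_sub U V f : V `<=` U -> smooth_on U f -> smooth_on V f.
Proof.
move=> VU sf i k; apply: Ck_sub (sf i k) => z /crd_imgP[dz /VU Vz].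
by apply/crd_imgP.
Qed.

Lemma smooth_smooth_on U f : smooth A f -> smooth_on U f.
Proof. by move=> sf i k; apply: Ck_sub (sf i k) => z /crd_imgP[]. Qed.

Lemma smooth_on_setU U V f : smooth_on U f -> smooth_on V f -> smooth_on (U `|` V) f.
Proof.
move=> sU sV i k; apply: Ck_local => z /crd_imgP[dz [Uz|Vz]].
  by exists (crd i @` (dom i `&` U)); split; [apply/crd_imgP|exact: sU].
by exists (crd i @` (dom i `&` V)); split; [apply/crd_imgP|exact: sV].
Qed.

Lemma smooth_onT f : smooth_on setT f -> smooth A f.
Proof. by move=> sf i; rewrite -[dom i]setIT; exact: sf. Qed.

Lemma smooth_on_eq U f g : open U -> (forall x, U x -> f x = g x) ->
  smooth_on U f -> smooth_on U g.
Proof.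
move=> oU fg sf i k; apply: Ck_eq (sf i k); first exact: open_crd_img.
by move=> z /crd_imgP[_ Uz]; exact: fg.
Qed.

Lemma smooth_on_cst U (a : R) : smooth_on U (cst a).
Proof. by move=> i k; exact: Ck_cst. Qed.

Lemma smooth_on_continuous U f x : open U -> smooth_on U f -> U x -> {for x, continuous f}.
Proof.
move=> oU sf Ux; have dx := chart_atP A x; set i := chart_at A x in dx.
have E : \near x, ((f \o par i) \o crd i) x = f x.
  by apply: open_near_eq dx; [exact: dom_open|move=> z dz /=; rewrite crdK].
apply: near_eq_for_continuous E _.
apply: continuous_comp; first exact: crd_continuous.
by apply: (Cinfty_continuous (sf i)); exists x.
Qed.

Lemma flow_line_crd (X : vector_field A) x c i : flow_line X x c -> dom i x ->
  differentiable (crd i \o c) (0 : R) /\ 'D_1 (crd i \o c) 0 = X i x.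
Proof.
move=> cX dx; have [c0 /nbhs_singleton[_ dc]] := cX.
rewrite c0 in dc.
have dcb a b : is_derive (0 : R) (1 : R) (fun r => (crd i \o c) r a b) (X i x a b).
  by rewrite ord1; exact: dc.
have der : derivable (crd i \o c) (0 : R) 1.
  by apply/derivable_mxP => a b; case: (dcb a b).
split; first exact/derivable1_diffP.
rewrite derive_mx//; apply/matrixP => a b; rewrite mxE.
exact: (@derive_val _ _ _ _ _ _ _ (dcb a b)).
Qed.

Lemma smooth_on_is_lie (X : vector_field A) U f x i : open U -> smooth_on U f ->
  U x -> dom i x -> (exists c, flow_line X x c) ->
  is_lie X f x ('D_(X i x) (f \o par i) (crd i x)).
Proof.
move=> oU sf Ux dx ec; split => // c cX; have [c0 _] := cX.
have [dc Dc] := flow_line_crd cX dx.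
have E : \forall s \near (0:R), ((f \o par i) \o (crd i \o c)) s = (f \o c) s.
  by apply: filterS (flow_line_near cX (dom_nbhs dx)) => s ds /=; rewrite crdK.
apply: near_eq_is_derive E _.
have df : differentiable (f \o par i) ((crd i \o c) 0).
  by rewrite /= c0; apply: (Cinfty_differentiable (sf i)); exists x.
have dfc := differentiable_comp dc df.
apply: DeriveDef; first exact: diff_derivable.
have := deriveE (1:R) dc; rewrite Dc => ->.
rewrite deriveE// diff_comp//= c0 deriveE//.
by rewrite /= c0 in df.
Qed.

Lemma smooth_on_lie (X : vector_field A) U f : open U -> smooth_on U f ->
  (forall x, U x -> exists c, flow_line X x c) -> smooth_on U (lie X f).
Proof.
move=> oU sf fl i k; have oV := @open_crd_img i U oU.
apply: (@Ck_eq _ _ _ _ (fun z => \sum_(b < n)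
  (X i (par i z) ord0 b * 'D_(basis_vec b) (f \o par i) z))) => //.
  move=> z [x [dx Ux] <-] /=; rewrite crdK//.
  rewrite (lieE (smooth_on_is_lie oU sf Ux dx _)); last exact: fl.
  rewrite derive_rowE//; last by apply: (Cinfty_differentiable (sf i)); exists x.
apply: Ck_sum => // b; apply: (@Ck_M _ _ _ _ (fun z => X i (par i z) ord0 b)) => //.
  by apply: Ck_sub (comp_smooth X i b k) => z /crd_imgP[].
exact: Cinfty_derive.
Qed.

Lemma smooth_on_C1 N (X : 'I_N -> vector_field A) U f : open U -> smooth_on U f ->
  flows X U -> C1 X U f.
Proof.
move=> oU sf fl; have sl k : smooth_on U (lie (X k) f) by apply: smooth_on_lie => //; exact: fl.
split=> [x Ux|k x Ux]; first exact: smooth_on_continuous Ux.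
split; last exact: smooth_on_continuous (sl k) Ux.
exists ('D_(X k (chart_at A x) x) (f \o par (chart_at A x)) (crd (chart_at A x) x)).
exact: (smooth_on_is_lie oU sf Ux (chart_atP A x) (fl k x Ux)).
Qed.

End SmoothFunctions.
Arguments smooth_on {R n M} A U f.

(** * Test functions *)

Section Bump.
Context {R : realType} {n : nat} {M : ptopologicalType} {A : manifold R n M}.
Implicit Types (U V : set M).

Definition box (c : 'rV[R]_n) (r : R) : set 'rV[R]_n :=
  [set z | forall b, `|z ord0 b - c ord0 b| <= r].

Lemma compact_box c r : compact (box c r).
Proof.
rewrite (_ : box c r = [set z | forall b, (`[c ord0 b - r, c ord0 b + r]%classic : set R) (z ord0 b)]).
  apply: (@rV_compact _ _ (fun b => `[c ord0 b - r, c ord0 b + r]%classic)) => b.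
  exact: segment_compact.
by apply/seteqP; split => z /= h b; have := h b; rewrite /= in_itv/= ler_distl.
Qed.

Lemma nbhs_box c (U : set 'rV[R]_n) : nbhs c U -> exists2 r, 0 < r & box c r `<=` U.
Proof.
move=> /nbhs_ballP[e /= e0 eU]; exists (e / 2); first by rewrite divr_gt0.
move=> z cz; apply: eU; rewrite -ball_normE /= distrC.
rewrite /Num.Def.normr/= mx_normrE; apply: bigmax_lt => // -[i b] _.
by rewrite !mxE ord1 (le_lt_trans (cz b))// ltr_pdivrMr// ltr_pMr// ltr1n.
Qed.

Lemma chart_box U x i : open U -> U x -> dom (m:=A) i x ->
  exists2 r, 0 < r & box (crd i x) r `<=` crd i @` (dom i `&` U).
Proof.
move=> oU Ux dx; apply: nbhs_box; apply: open_nbhs_nbhs; split.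
  exact: open_crd_img.
by exists x.
Qed.

Lemma compact_par_box (i : chart A) c r : box c r `<=` crd i @` dom i ->
  compact (par i @` box c r).
Proof.
move=> cr; apply: continuous_compact; last exact: compact_box.
by apply: continuous_in_subspaceT => z /set_mem /cr; exact: par_continuous.
Qed.

Lemma exists_test_function U x0 : open U -> U x0 ->
  exists phi : M -> R, [/\ test_function A U phi, forall x, 0 <= phi x & 0 < phi x0].
Proof.
move=> oU Ux0; have dx0 := chart_atP A x0; set i := chart_at A x0 in dx0.
have [r r0 rU] := chart_box oU Ux0 dx0; set c := crd i x0 in rU.
pose K := par i @` box c r.
have KU x : K x -> dom i x /\ U x.
  by move=> [z /rU[w [dw Uw] <-] <-]; rewrite crdK.
have cK : compact K.
  by apply: compact_par_box => z /rU[w [dw _] <-]; exists w.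
have clK : closed K by apply: compact_closed => //; exact: man_hausdorff A.
pose q x := \sum_(b < n) (crd i x ord0 b - c ord0 b) ^+ 2.
pose phi x : R := if x \in dom i then expV 1 (r ^+ 2 - q x) else 0.
have phiK x : phi x != 0 -> K x.
  rewrite /phi; case: ifPn => [/set_mem dx|]; last by rewrite eqxx.
  move=> h; have {h} : 0 < expV 1 (r ^+ 2 - q x) by rewrite lt_neqAle eq_sym h expV_ge0.
  rewrite expV_gt0 subr_gt0 => qr.
  exists (crd i x); last by rewrite crdK.
  move=> b; rewrite -ler_sqr ?nnegrE//; last exact: ltW.
  rewrite real_normK ?num_real//.
  apply: le_trans (ltW qr); rewrite /q (bigD1 b)//= lerDl.
  by apply: sumr_ge0 => ? _; exact: sqr_ge0.
have sphi : Defs.support phi `<=` K by rewrite /Defs.support closureE; apply: smallest_sub.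
have oKC : open (~` K) by rewrite openC.
exists phi; split.
- split.
  + apply: smooth_onT; apply: (@smooth_on_sub _ _ _ _ (dom i `|` ~` K)).
      by move=> x _; have [/KU[? _]|?] := pselect (K x); [left|right].
    apply: smooth_on_setU.
      move=> j k; have oj : open (crd j @` (dom j `&` dom i)).
        by apply: open_crd_img; exact: dom_open.
      apply: (@Ck_eq _ _ _ _ (expV 1 \o (fun z => r ^+ 2 - q (par j z)))) => //.
        by move=> z /crd_imgP[_ diz]; rewrite /phi/= mem_set.
      apply: Ck_comp => //; first exact: smooth1_expV.
      have cr2 := @Ck_cst R n k (crd j @` (dom j `&` dom i)) (r ^+ 2).
      apply: (@Ck_D _ _ _ _ (cst (r ^+ 2)) (fun z => - q (par j z))) => //.
      rewrite (_ : (fun _ => _) = (fun z => \sum_(b < n)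
        ((cst (-1) \* (fun z => crd i (par j z) ord0 b + (- c ord0 b))) \*
        (fun z => crd i (par j z) ord0 b + (- c ord0 b))) z)); last first.
        apply/funext => z; rewrite /q -sumrN; apply: eq_bigr => b _ /=.
        by rewrite expr2 mulNr mul1r mulNr.
      apply: Ck_sum => // b.
      have Cb : Ck k (crd j @` (dom j `&` dom i)) (fun z => crd i (par j z) ord0 b + (- c ord0 b)).
        apply: (@Ck_D _ _ _ _ (fun z => crd i (par j z) ord0 b) (cst (- c ord0 b))) => //.
          exact: transition_smooth.
        exact: Ck_cst.
      by apply: Ck_M => //; apply: Ck_M => //; exact: Ck_cst.
    apply: (@smooth_on_eq _ _ _ _ _ (cst 0)) => //; last exact: smooth_on_cst.
    by move=> x nK; apply/esym/eqP/negPn/negP => /phiK.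
  + apply: (subclosed_compact _ cK sphi); exact: closed_closure.
  + by move=> x /sphi/KU[].
- by move=> x; rewrite /phi; case: ifP => // _; exact: expV_ge0.
- rewrite /phi mem_set//.
  rewrite expV_gt0 (_ : q x0 = 0) ?subr0 ?exprn_gt0//.
  by rewrite /q big1// => b _; rewrite subrr expr0n.
Qed.
End Bump.

(** * The measure of a volume form *)

Section LebesgueInt.
Context {R : realType}.
Local Open Scope ereal_scope.

(* Unlike [ge0_le_integral], this covers nonmeasurable functions. *)
Lemma ge0_le_integralT d (T : measurableType d) (mu : {measure set T -> \bar R})
    (f g : T -> \bar R) :
  (forall x, 0 <= f x) -> (forall x, f x <= g x) -> \int[mu]_x f x <= \int[mu]_x g x.
Proof.
move=> f0 fg; have g0 x : 0 <= g x by exact: le_trans (f0 x) (fg x).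
rewrite !ge0_integralTE//; apply: ereal_sup_le => _ [h hf <-].
by exists h => // x; exact: le_trans (hf x) (fg x).
Qed.

Lemma lebesgue_int_ge0 n (f : 'rV[R]_n -> \bar R) :
  (forall z, 0 <= f z) -> 0 <= lebesgue_int f.
Proof.
elim: n f => [|n IH] f f0 /=; first exact: f0.
by apply: integral_ge0 => s _; apply: IH.
Qed.

Lemma le_lebesgue_int n (f g : 'rV[R]_n -> \bar R) :
  (forall z, 0 <= f z) -> (forall z, f z <= g z) -> lebesgue_int f <= lebesgue_int g.
Proof.
elim: n f g => [|n IH] f g f0 fg /=; first exact: fg.
by apply: ge0_le_integralT => s; [exact: lebesgue_int_ge0|exact: IH].
Qed.

Lemma lebesgue_int0 n : lebesgue_int (fun _ : 'rV[R]_n => 0) = 0.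
Proof.
by elim: n => [|n IH] //=; under eq_integral do rewrite IH; rewrite integral0.
Qed.

Lemma box_row_mx n (c : 'rV[R]_n.+1) (r s : R) (z : 'rV[R]_n) :
  box c r (row_mx (s%:M : 'rV[R]_1) z) <->
  (`|s - c ord0 ord0| <= r)%R /\ box (rsubmx (c : 'M[R]_(1, 1 + n))) r z.
Proof.
set c' := (c : 'M[R]_(1, 1 + n)); set w := row_mx (s%:M : 'rV[R]_1) z.
have -> : box c r w <-> forall b : 'I_(1 + n), (`|w ord0 b - c' ord0 b| <= r)%R by [].
have c0 : c ord0 ord0 = c' ord0 (lshift n ord0) by congr (c _ _); exact: val_inj.
split=> [h|[hs hz] b].
  split=> [|b]; last by have := h (rshift 1 b); rewrite row_mxEr mxE.
  by have := h (lshift n ord0); rewrite row_mxEl mxE mulr1n c0.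
have [j ->|j ->] := @split_ordP 1 n b.
  by rewrite row_mxEl mxE !ord1 mulr1n -c0.
by rewrite row_mxEr; have := hz j; rewrite mxE.
Qed.

Lemma lebesgue_int_box n (c : 'rV[R]_n) (r C : R) : (0 <= r)%R -> (0 <= C)%R ->
  lebesgue_int (fun z => if z \in box c r then C%:E else 0) = (C * (2 * r) ^+ n)%:E.
Proof.
move=> r0 C0; elim: n c => [|n IH] c /=.
  by rewrite mem_set ?mulr1// => -[].
set I : set R := `[(c ord0 ord0 - r)%R, (c ord0 ord0 + r)%R]%classic.
have E s : lebesgue_int (fun z : 'rV[R]_n =>
    if row_mx (s%:M : 'rV[R]_1) z \in box c r then C%:E else 0) =
    (cst (C * (2 * r) ^+ n)%:E \_ I) s.
  rewrite patchE; case: ifPn => sI.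
    rewrite /= -(IH (rsubmx (c : 'M[R]_(1, 1 + n)))); congr lebesgue_int; apply/funext => z.
    congr (if _ then _ else _); apply/idP/idP => /set_mem h; apply/mem_set.
      by have [] := (box_row_mx _ _ _ _).1 h.
    apply/box_row_mx; split => //.
    by move/set_mem : sI; rewrite /I /= in_itv/= ler_distl.
  rewrite (_ : (fun _ => _) = (fun _ => 0)) ?lebesgue_int0//; apply/funext => z.
  rewrite ifF//; apply/negbTE; apply: contra sI => /set_mem/box_row_mx[+ _].
  by rewrite inE /I /= in_itv/= ler_distl.
under eq_integral do rewrite E.
have mI : @lebesgue_measure R I = (2 * r)%:E.
  rewrite /I lebesgue_measure_itv/= lte_fin; case: ifPn => [_|].
    by rewrite -EFinD; congr (_%:E); ring.
  by rewrite -leNgt => h; congr (_%:E); lra.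
rewrite -integral_mkcond integral_cst; last exact: measurable_itv.
by rewrite [X in _ * X]mI -EFinM exprSr mulrA.
Qed.
End LebesgueInt.

Section VolumeMeasure.
Context {R : realType} {n : nat} {M : ptopologicalType} {A : manifold R n M}.
Context {dnu : volume_form A} {nu : {measure set (borel M) -> \bar R}}.
Hypothesis hnu : volume_measure dnu nu.
Local Open Scope ereal_scope.

Lemma open_measurable_borel (U : set (borel M)) : @open M U -> measurable U.
Proof. by move=> oU; apply: sub_sigma_algebra. Qed.

Lemma closed_measurable_borel (U : set (borel M)) : @closed M U -> measurable U.
Proof.
move=> cU; rewrite -(setCK U); apply: measurableC; apply: open_measurable_borel.
by rewrite openC.
Qed.

Let dens i x := (`|dnu i x|)%R.

Lemma dens_continuous i z : (crd i @` dom (m:=A) i) z ->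
  {for z, continuous (fun z => dens i (par i z))}.
Proof.
move=> dz; apply: (@continuous_comp _ _ _ (fun z => dnu i (par i z)) (fun r : R => `|r|%R)).
  exact: (Cinfty_continuous (density_smooth dnu i)).
exact: norm_continuous.
Qed.

Lemma nu_le_box (B : set (borel M)) i c (r C : R) : measurable B -> B `<=` dom (m:=A) i ->
  (0 <= r)%R -> (0 <= C)%R -> crd i @` B `<=` box c r ->
  (forall x, B x -> (dens i x <= C)%R) -> nu B <= (C * (2 * r) ^+ n)%:E.
Proof.
move=> mB Bi r0 C0 Bc BC; rewrite (hnu mB Bi) -(lebesgue_int_box c)//.
apply: le_lebesgue_int => z; first by case: ifP => // _; rewrite lee_fin.
case: ifPn => [/set_mem zB|_]; last by case: ifP => // _; rewrite lee_fin.
rewrite mem_set; last exact: Bc.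
by have [x Bx <-] := zB; rewrite lee_fin crdK; [exact: BC|exact: Bi].
Qed.

Lemma nu_ge_box (B : set (borel M)) i c (r C : R) : measurable B -> B `<=` dom (m:=A) i ->
  (0 <= r)%R -> (0 <= C)%R -> box c r `<=` crd i @` B ->
  (forall x, B x -> (crd i @^-1` box c r) x -> (C <= dens i x)%R) ->
  (C * (2 * r) ^+ n)%:E <= nu B.
Proof.
move=> mB Bi r0 C0 Bc BC; rewrite (hnu mB Bi) -(lebesgue_int_box c)//.
apply: le_lebesgue_int => z; first by case: ifP => // _; rewrite lee_fin.
case: ifPn => [/set_mem zB|_]; last by case: ifP => // _; rewrite lee_fin.
rewrite mem_set; last exact: Bc.
have [x Bx xz] := Bc _ zB; rewrite -xz lee_fin crdK; last exact: Bi.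
by apply: BC => //; rewrite /preimage/= xz.
Qed.

Lemma nu_open_gt0 (U : set (borel M)) x : @open M U -> U x -> 0 < nu U.
Proof.
move=> oU Ux; have dx := chart_atP A x; set i := chart_at A x in dx.
have cx : (crd i @` dom i) (crd i x) by exists x.
have d0 : (0 < dens i x)%R by rewrite normr_gt0 density_neq0.
have nd : \forall z \near crd i x, (dens i x / 2 <= dens i (par i z))%R.
  have := dens_continuous cx; rewrite /prop_for /continuous_at /= crdK// => cz.
  by apply: cvgr_ge cz _ _; rewrite ltr_pdivrMr// ltr_pMr// ltr1n.
have [r1 r10 h1] := nbhs_box nd.
have [r2 r20 h2] := chart_box oU Ux dx.
pose r := Num.min r1 r2; have r0 : (0 < r)%R by rewrite lt_min r10 r20.
have mB : measurable (dom i `&` U : set (borel M)).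
  by apply: open_measurable_borel; apply: openI => //; exact: dom_open.
apply: (@lt_le_trans _ _ (nu (dom i `&` U))); last first.
  by apply: le_measure; rewrite ?inE//; exact: open_measurable_borel.
apply: lt_le_trans (@nu_ge_box _ i (crd i x) r (dens i x / 2) mB _ _ _ _ _).
- by rewrite lte_fin mulr_gt0 ?exprn_gt0 ?divr_gt0 ?mulr_gt0.
- by move=> ? [].
- exact: ltW.
- by apply: ltW; rewrite divr_gt0.
- by move=> z hz; apply: h2 => b; rewrite (le_trans (hz b))// ge_min lexx orbT.
- move=> w [dw Uw] hw; have := h1 (crd i w); rewrite /= crdK//; apply=> b.
  by rewrite (le_trans (hw b))// ge_min lexx.
Qed.

Lemma nu_local_finite x : exists U : set M, [/\ open U, U x & nu U < +oo].
Proof.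
have dx := chart_atP A x; set i := chart_at A x in dx.
have cx : (crd i @` dom i) (crd i x) by exists x.
have nd : \forall z \near crd i x, (dens i (par i z) <= dens i x + 1)%R.
  have := dens_continuous cx; rewrite /prop_for /continuous_at /= crdK// => cz.
  by apply: cvgr_le cz _ _; rewrite ltrDl.
have [r r0 h] := nbhs_box nd.
have nb : nbhs (crd i x) (box (crd i x) r).
  apply/nbhs_ballP; exists r => //= z; rewrite -ball_normE /= => zr b.
  rewrite distrC; apply: le_trans (ltW zr).
  rewrite [leRHS]/Num.Def.normr/= mx_normrE.
  by have := le_bigmax 0%R (fun ij => `|(crd i x - z) ij.1 ij.2|%R) (ord0, b); rewrite /= !mxE.
have nx : nbhs x (dom i `&` (crd i @^-1` box (crd i x) r)).
  by apply: filterI; [exact: dom_nbhs|exact: (crd_continuous dx)].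
exists ((dom i `&` (crd i @^-1` box (crd i x) r))^°); split.
- exact: open_interior.
- exact: nx.
- set U := _^°; have UB : U `<=` dom i `&` (crd i @^-1` box (crd i x) r) by exact: interior_subset.
  apply: le_lt_trans (@nu_le_box U i (crd i x) r (dens i x + 1) _ _ _ _ _ _) _.
  + by apply: open_measurable_borel; exact: open_interior.
  + by move=> w /UB[].
  + exact: ltW.
  + by apply: addr_ge0; [exact: normr_ge0|].
  + by move=> _ [w /UB[_ ?] <-].
  + by move=> w /UB[dw hw]; have := h _ hw; rewrite /= crdK.
  + exact: ltry.
Qed.

Lemma nu_compact_finite (K : set (borel M)) : @compact M K -> nu K < +oo.
Proof.
move=> cK; pose V x := sval (cid (nu_local_finite x)).
have VP x : [/\ open (V x), V x x & nu (V x) < +oo] by exact: svalP (cid (nu_local_finite x)).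
have := cK; rewrite compact_cover => /(_ M setT V).
have mK : measurable K.
  by apply: closed_measurable_borel; apply: compact_closed => //; exact: man_hausdorff A.
case=> [x _|x _|D _ KD]; [by case: (VP x)|by exists x => //; case: (VP x)|].
have := @content_sub_fsum _ _ _ nu _ [set` D] K V (finite_fset D) _ mK KD.
move=> /(_ _)/le_lt_trans; apply.
  by move=> x _; apply: open_measurable_borel; case: (VP x).
rewrite fsbig_finite//=; apply: lte_sum_pinfty => x _.
by case: (VP x).
Qed.

End VolumeMeasure.

Lemma nu_set1 {R : realType} {n : nat} {M : ptopologicalType} {A : manifold R n.+1 M}
  {dnu : volume_form A} {nu : {measure set (borel M) -> \bar R}} (x : M) :
  volume_measure dnu nu -> nu [set x] = 0%E.
Proof.
move=> hnu; have mx : measurable ([set x] : set (borel M)).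
  apply: closed_measurable_borel.
  apply: accessible_closed_set1; apply: hausdorff_accessible; exact: man_hausdorff A.
have dx := chart_atP A x; set i := chart_at A x in dx.
apply/eqP; rewrite eq_le measure_ge0 andbT.
apply: le_trans (@nu_le_box _ _ _ _ dnu nu hnu _ i (crd i x) 0 `|dnu i x| mx _ _ _ _ _) _ => //.
- by move=> _ ->.
- by move=> _ [_ -> <-] b; rewrite subrr normr0.
- by move=> _ ->.
- by rewrite mulr0 expr0n/= mulr0.
Qed.

(** * Integrals over cubes and clamping *)

Section CubeIntegral.
Context {R : realType}.
Implicit Types (n : nat).

Lemma for_continuousD (T : topologicalType) (f g : T -> R) x :
  {for x, continuous f} -> {for x, continuous g} ->
  {for x, continuous (fun t => f t + g t)}.
Proof. by move=> cf cg; exact: (cvgD cf cg). Qed.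

Lemma for_continuousM (T : topologicalType) (f g : T -> R) x :
  {for x, continuous f} -> {for x, continuous g} ->
  {for x, continuous (fun t => f t * g t)}.
Proof. by move=> cf cg; exact: (cvgM cf cg). Qed.

Lemma for_continuousZ (T : topologicalType) (f : T -> R) a x :
  {for x, continuous f} -> {for x, continuous (fun t => a * f t)}.
Proof. by move=> cf; apply: for_continuousM => //; exact: cvg_cst. Qed.

Lemma for_continuous_lin (T : topologicalType) (f g : T -> R) a x :
  {for x, continuous f} -> {for x, continuous g} ->
  {for x, continuous (fun t => f t + a * g t)}.
Proof. by move=> cf cg; apply: for_continuousD => //; exact: for_continuousZ. Qed.

Local Notation rowc s z := (row_mx (s%:M : 'rV[R]_1) z).

Lemma closed_cube_row_mx n (s : R) (z : 'rV[R]_n) :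
  closed_cube (n:=n.+1) (rowc s z) <-> 0 <= s <= 1 /\ closed_cube z.
Proof.
set w := rowc s z.
have -> : closed_cube (n:=n.+1) w <-> forall b : 'I_(1 + n), 0 <= w ord0 b <= 1 by [].
split=> [h|[hs hz] b].
  split=> [|b]; last by have := h (rshift 1 b); rewrite row_mxEr.
  by have := h (lshift n ord0); rewrite row_mxEl mxE mulr1n.
have [j ->|j ->] := @split_ordP 1 n b; last by rewrite row_mxEr.
by rewrite row_mxEl mxE !ord1 mulr1n.
Qed.

Lemma eq_cube_int n (f g : 'rV[R]_n -> R) :
  (forall t, closed_cube t -> f t = g t) -> cube_int f = cube_int g.
Proof.
elim: n f g => [|n IH] f g fg /=; first by apply: fg => -[].
apply: eq_Rintegral => s; rewrite inE /= in_itv/= => s01.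
by apply: IH => z hz; apply: fg; apply/closed_cube_row_mx.
Qed.

Lemma cube_int0 n : cube_int (fun _ : 'rV[R]_n => 0) = 0.
Proof.
elim: n => [|n IH] //=; under eq_Rintegral do rewrite IH.
by rewrite Rintegral_cst// mul0r.
Qed.

Lemma continuous_rowc n : continuous (fun p : 'rV[R]_n * R => rowc p.2 p.1).
Proof.
move=> p; apply/cvg_ballP => e e0; apply: filterS (nbhsx_ballx p e e0) => q [h1 h2].
split=> // i j; rewrite !ord1; move: j.
suff : forall j : 'I_(1 + n), ball (rowc p.2 p.1 ord0 j) e (rowc q.2 q.1 ord0 j) by [].
move=> j; have [b ->|b ->] := @split_ordP 1 n j.
  by rewrite !row_mxEl !mxE !ord1 !mulr1n.
rewrite !row_mxEr; case: h1 => _; exact.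
Qed.

Lemma compact_closed_cube n : compact (closed_cube (R:=R) (n:=n)).
Proof.
rewrite (_ : closed_cube (n:=n) = [set v | forall i : 'I_n, (`[0, 1]%classic : set R) (v ord0 i)]).
  by apply: (@rV_compact R _ (fun=> `[0, 1]%classic)) => i; exact: segment_compact.
by apply/seteqP; split => z /= h b; have := h b; rewrite /= in_itv.
Qed.

Lemma continuous_fiber n (f : 'rV[R]_n.+1 -> R) (s : R) : continuous f ->
  continuous (fun z => f (rowc s z)).
Proof.
move=> cf z; apply: continuous_comp; last exact: cf.
apply: (@continuous_comp _ _ _ (fun z => (z, s)) (fun p : 'rV[R]_n * R => rowc p.2 p.1)).
  move=> B [[P Q] [/= Pz Qs] PQB]; apply: filterS Pz => w Pw; apply: PQB.
  by split=> //=; exact: nbhs_singleton.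
exact: continuous_rowc.
Qed.

Let cint (F : R -> R) : continuous F ->
  (@lebesgue_measure R).-integrable `[0, 1]%classic (EFin \o F).
Proof.
move=> cF; apply: continuous_compact_integrable; first exact: segment_compact.
exact: continuous_subspaceT.
Qed.

Let fineI : fine ((@lebesgue_measure R) `[0, 1]%classic) = 1.
Proof. by rewrite lebesgue_measure_itv/= lte_fin ltr01 /= subr0. Qed.

Let cube_int_main n :
  (forall (f g : 'rV[R]_n -> R) a, continuous f -> continuous g ->
     cube_int (fun t => f t + a * g t) = cube_int f + a * cube_int g) /\
  (forall (f : 'rV[R]_n -> R) e, continuous f ->
     (forall t, closed_cube t -> `|f t| <= e) -> `|cube_int f| <= e).
Proof.
elim: n => [|n [IHl IHb]]; first by split=> [//|f e _ /=]; apply=> -[].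
have cF (f : 'rV[R]_n.+1 -> R) : continuous f -> continuous (fun s => cube_int (fun z : 'rV[R]_n => f (rowc s z))).
  move=> cf s0; have cfib s := @continuous_fiber n f s cf.
  apply/cvgrPdist_le => /= e e0.
  have nc := (compact_near_coveringP _).1 (@compact_closed_cube n).
  have : \forall s \near s0, closed_cube (n:=n) `<=`
      (fun z => `|f (rowc s0 z) - f (rowc s z)| <= e).
    apply: (nc _ (nbhs s0) (fun s z => `|f (rowc s0 z) - f (rowc s z)| <= e)) => z _.
    have c1 : f (rowc p.2 p.1) @[p --> (z, s0)] --> f (rowc s0 z).
      exact: (cvg_comp _ _ (@continuous_rowc n (z, s0)) (cf _)).
    have c2 : f (rowc s0 z') @[z' --> z] --> f (rowc s0 z) by exact: cfib.
    have e2 : 0 < e / 2 by rewrite divr_gt0.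
    have /cvgrPdist_le/(_ _ e2) n1 := c1.
    have /cvgrPdist_le/(_ _ e2) n2 := c2.
    have n3 : \forall p \near (z, s0), `|f (rowc s0 z) - f (rowc s0 p.1)| <= e / 2.
      exists ([set z' | `|f (rowc s0 z) - f (rowc s0 z')| <= e / 2], setT).
        by split => //; exact: filterT.
      by move=> p [].
    apply: filterS2 n1 n3 => -[z' s] /= h1 h2.
    rewrite -(subrKA (f (rowc s0 z))) (le_trans (ler_normD _ _))// (splitr e) lerD//.
    by rewrite distrC.
  apply: filterS => s hs.
  rewrite -[X in _ - X]mul1r -mulNr -IHl; [|exact: continuous_fiber..].
  apply: IHb; last by move=> z /hs; rewrite mulN1r.
  move=> z; exact: (for_continuous_lin (cfib s0 z) (cfib s z)).
split=> [f g a cf cg|f e cf fe] /=.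
  have E s : cube_int (fun z : 'rV[R]_n => f (rowc s z) + a * g (rowc s z)) =
      cube_int (fun z => f (rowc s z)) + a * cube_int (fun z => g (rowc s z)).
    by apply: IHl; exact: continuous_fiber.
  under eq_Rintegral do rewrite E.
  rewrite RintegralD//; last 2 first.
  - by apply: cint; exact: cF.
  - by apply: cint => s; exact: (for_continuousZ (cF g cg s)).
  by rewrite RintegralZl//; apply: cint; exact: cF.
have iF := cint (cF f cf).
apply: (le_trans (le_normr_Rintegral _ iF)) => //.
rewrite [leRHS](_ : e = \int[@lebesgue_measure R]_(_ in `[0, 1]%classic) e); last first.
  by rewrite Rintegral_cst// fineI mulr1.
apply: le_Rintegral => //.
- by apply: cint => s; apply: (@continuous_comp _ _ _ _ (fun x : R => `|x|)); [exact: cF|exact: norm_continuous].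
- by apply: cint => s; exact: cvg_cst.
- move=> s /=; rewrite in_itv/= => s01; apply: IHb; first exact: continuous_fiber.
  by move=> z hz; apply: fe; apply/closed_cube_row_mx.
Qed.

Definition clamp n (t : 'rV[R]_n) : 'rV[R]_n := \row_b Num.max 0 (Num.min 1 (t ord0 b)).

Lemma clamp_cube n (t : 'rV[R]_n) : closed_cube (clamp t).
Proof. by move=> b; rewrite mxE le_max lexx/= ge_max ler01/= ge_min lexx. Qed.

Lemma clamp_id n (t : 'rV[R]_n) : closed_cube t -> clamp t = t.
Proof.
move=> ct; apply/rowP => b; rewrite mxE; have /andP[t0 t1] := ct b.
by rewrite (min_idPr t1) (max_idPr t0).
Qed.

Lemma clamp1_lipschitz (x y : R) :
  `|Num.max 0 (Num.min 1 x) - Num.max 0 (Num.min 1 y)| <= `|x - y|.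
Proof.
have h1 := ler_norm (x - y); have h2 := ler_norm (y - x); rewrite distrC in h2.
by case: (leP 1 x) => x1; case: (leP 1 y) => y1; rewrite ?(max_r ler01);
  case: (leP 0 x) => x0; case: (leP 0 y) => y0;
  rewrite ler_norml; apply/andP; split; lra.
Qed.

Lemma continuous_clamp n : continuous (@clamp n).
Proof.
move=> t; have FF : Filter (nbhs t) := nbhs_filter t.
apply/cvg_ballP => e e0; apply: filterS (nbhsx_ballx t e e0) => s [_ ts].
split=> // i b; rewrite !mxE !ord1; have := ts ord0 b.
rewrite -!ball_normE /=; apply: le_lt_trans.
exact: clamp1_lipschitz.
Qed.

Lemma continuous_comp_clamp n (f : 'rV[R]_n -> R) :
  {within closed_cube (n:=n), continuous f} -> continuous (f \o @clamp n).
Proof.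
move=> /subspace_continuousP cf t.
have := cf (clamp t) (clamp_cube t).
move=> h B nB; have nB' := h B nB.
have FF : Filter (nbhs t) := nbhs_filter t.
have h2 : nbhs t (clamp (n:=n) @^-1` _) := @continuous_clamp n t _ nB'.
exact: (@filterS _ (nbhs t) FF _ _ (fun s hs => hs (clamp_cube s)) h2).
Qed.

Lemma cube_int_clamp n (f : 'rV[R]_n -> R) : cube_int f = cube_int (f \o @clamp n).
Proof. by apply: eq_cube_int => t ct /=; rewrite clamp_id. Qed.

Lemma cube_int_lin n (f g : 'rV[R]_n -> R) a :
  {within closed_cube (n:=n), continuous f} -> {within closed_cube (n:=n), continuous g} ->
  cube_int (fun t => f t + a * g t) = cube_int f + a * cube_int g.
Proof.
move=> cf cg; rewrite (cube_int_clamp f) (cube_int_clamp g) (cube_int_clamp (fun _ => _)).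
rewrite -(cube_int_main n).1; [by []| |]; exact: continuous_comp_clamp.
Qed.

Lemma cube_int_sum n (I : Type) (r : seq I) (f : I -> 'rV[R]_n -> R) :
  (forall i, {within closed_cube (n:=n), continuous (f i)}) ->
  cube_int (fun t => \sum_(i <- r) f i t) = \sum_(i <- r) cube_int (f i).
Proof.
move=> cf.
elim: r => [|i r IH]; first by under eq_fun do rewrite big_nil; rewrite big_nil cube_int0.
under eq_fun do rewrite big_cons -[X in _ + X]mul1r.
rewrite cube_int_lin ?IH ?mul1r ?big_cons//.
elim: r {IH} => [|j r IH]; first by under eq_fun do rewrite big_nil; move=> t; exact: cvg_cst.
by under eq_fun do rewrite big_cons; move=> t; exact: (for_continuousD (cf j t) (IH t)).
Qed.

End CubeIntegral.

(** * Boundary integrals *)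

Lemma for_continuous_sum (R : realType) (T : topologicalType) (I : Type) (r : seq I) (F : I -> T -> R) x :
  (forall i, {for x, continuous (F i)}) -> {for x, continuous (fun t => \sum_(i <- r) F i t)}.
Proof.
move=> cF; elim: r => [|i r IH].
  have -> : (fun t => \sum_(i <- [::]) F i t) = cst 0 by apply/funext => t; rewrite big_nil.
  exact: cvg_cst.
have -> : (fun t => \sum_(j <- i :: r) F j t) = (fun t => F i t + \sum_(j <- r) F j t).
  by apply/funext => t; rewrite big_cons.
exact: for_continuousD.
Qed.

Lemma for_continuous_prod (R : realType) (T : topologicalType) (I : Type) (r : seq I) (F : I -> T -> R) x :
  (forall i, {for x, continuous (F i)}) -> {for x, continuous (fun t => \prod_(i <- r) F i t)}.
Proof.
move=> cF; elim: r => [|i r IH].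
  have -> : (fun t => \prod_(i <- [::]) F i t) = cst 1 by apply/funext => t; rewrite big_nil.
  exact: cvg_cst.
have -> : (fun t => \prod_(j <- i :: r) F j t) = (fun t => F i t * \prod_(j <- r) F j t).
  by apply/funext => t; rewrite big_cons.
exact: for_continuousM.
Qed.

Lemma for_continuous_det (R : realType) (T : topologicalType) n (F : T -> 'M[R]_n) x :
  (forall i j, {for x, continuous (fun t => F t i j)}) -> {for x, continuous (fun t => \det (F t))}.
Proof.
move=> cF; rewrite /determinant; apply: for_continuous_sum => s.
by apply: for_continuousZ; apply: for_continuous_prod => i; exact: cF.
Qed.

Lemma within_continuous_comp (T U V : topologicalType) (A : set T) (B : set U)
    (f : U -> V) (g : T -> U) :
  (forall t, A t -> {for t, continuous g}) -> (forall t, A t -> B (g t)) ->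
  {within B, continuous f} -> {within A, continuous (f \o g)}.
Proof.
move=> cg AB /subspace_continuousP cf; apply/subspace_continuousP => t At W nW.
have h1 := cf _ (AB t At) W nW.
have h2 : nbhs t (g @^-1` _) := cg t At _ h1.
have FF : Filter (nbhs t) := nbhs_filter t.
exact: (@filterS _ (nbhs t) FF _ _ (fun s hs As => hs (AB s As)) h2).
Qed.

Lemma within_continuousM (R : realType) (T : topologicalType) (A : set T) (f g : T -> R) :
  {within A, continuous f} -> {within A, continuous g} ->
  {within A, continuous (fun t => f t * g t)}.
Proof. by move=> cf cg t; exact: (@for_continuousM _ (subspace A) f g t (cf t) (cg t)). Qed.

Lemma within_continuousD (R : realType) (T : topologicalType) (A : set T) (f g : T -> R) :
  {within A, continuous f} -> {within A, continuous g} ->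
  {within A, continuous (fun t => f t + g t)}.
Proof. by move=> cf cg t; exact: (@for_continuousD _ (subspace A) f g t (cf t) (cg t)). Qed.

Lemma within_continuous_sum (R : realType) (T : topologicalType) (A : set T) (I : Type)
    (r : seq I) (F : I -> T -> R) : (forall i, {within A, continuous (F i)}) ->
  {within A, continuous (fun t => \sum_(i <- r) F i t)}.
Proof.
move=> cF t.
exact: (@for_continuous_sum _ (subspace A) _ r F t (fun i => cF i t)).
Qed.

Lemma det_col_mx_row (R : comRingType) m (T : 'M[R]_(m, m.+1)) :
  exists c : 'I_m.+1 -> R, forall v : 'rV[R]_m.+1,
    \det (col_mx v T : 'M[R]_m.+1) = \sum_j v ord0 j * c j.
Proof.
pose C v : 'M[R]_(1 + m) := col_mx v T.
exists (fun j => cofactor (C 0) (lshift m ord0) j) => v.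
rewrite -[\det _]/(\det (C v)) (expand_det_row _ (lshift m ord0)).
apply: eq_bigr => j _; rewrite /C col_mxEu; congr (_ * _).
rewrite /cofactor; congr (_ * \det _); apply/matrixP => a b; rewrite !mxE.
case: splitP => // k /= E; exfalso.
by have := neq_bump 0 a; rewrite E; case: k {E} => -[].
Qed.

Section Boundary.
Context {R : realType} {m : nat} {M : ptopologicalType} {A : manifold R m.+1 M}.
Context {dnu : volume_form A} {Om : set M} {P : boundary_patches dnu Om}.
Local Notation cube := (closed_cube (n:=m)).

Lemma contraction_sum (sigma : 'rV[R]_m -> M) t N (a : 'I_N -> R) (v : 'I_N -> 'rV[R]_m.+1) :
  Defs.contraction dnu sigma t (\sum_k a k *: v k) = \sum_k a k * Defs.contraction dnu sigma t (v k).
Proof.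
rewrite /Defs.contraction; have [c E] := det_col_mx_row (tangent A sigma t).
rewrite E mulr_sumr (eq_bigr (fun j => \sum_k a k * (dnu (chart_at A (sigma t)) (sigma t) * (v k ord0 j * c j)))); last first.
  move=> j _; rewrite summxE mulr_suml mulr_sumr; apply: eq_bigr => k _.
  by rewrite mxE; ring.
rewrite exchange_big; apply: eq_bigr => k _; rewrite -mulr_sumr; congr (_ * _).
by rewrite E mulr_sumr.
Qed.

Lemma row_differentiable n n' (c : 'rV[R]_n -> 'rV[R]_n') t :
  (forall b, differentiable (fun r => c r ord0 b) t) -> differentiable c t.
Proof.
move=> dc; rewrite (_ : c = \sum_(b < n') (fun r => c r ord0 b *: basis_vec b)).
  by apply: differentiable_sum => b; exact: differentiableZl.
by apply/funext => r; rewrite fct_sumE; exact: row_sum_delta.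
Qed.

Section Patch.
Variables (sigma : 'rV[R]_m -> M) (V : set 'rV[R]_m).
Hypothesis oV : open V.
Hypothesis csigma : forall t, V t -> {for t, continuous sigma}.
Hypothesis C1sigma : forall (i : chart A) b,
  Ck 1 (V `&` sigma @^-1` dom i) (fun t => crd i (sigma t) ord0 b).

Let tang (i : chart A) t : 'M[R]_(m, m.+1) :=
  \matrix_(a, b) 'D_(basis_vec a) (fun r => crd i (sigma r) ord0 b) t.

Let dcrd (i : chart A) t b : V t -> dom i (sigma t) ->
  differentiable (fun r => crd i (sigma r) ord0 b) t.
Proof. by move=> Vt dt; have [+ _] := C1sigma i b; apply. Qed.

Lemma tang_change i j t : V t -> dom i (sigma t) -> dom j (sigma t) ->
  tang j t = tang i t *m transition_jac i j (sigma t).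
Proof.
move=> Vt di dj; apply/matrixP => a b; rewrite !mxE.
pose c r := crd i (sigma r).
pose phi z := crd j (par i z) ord0 b.
have dc : differentiable c t by apply: row_differentiable => b'; exact: dcrd.
have dphi : differentiable phi (c t).
  by apply: (Cinfty_differentiable (@transition_smooth _ _ _ A i j b)); exists (sigma t).
have E : \near t, (phi \o c) t = crd j (sigma t) ord0 b.
  have ni : nbhs t (sigma @^-1` dom i) by apply: (csigma Vt); exact: dom_nbhs.
  by apply: filterS ni => r /= dr; rewrite /phi /c crdK.
have D1 : 'D_(basis_vec a) (phi \o c) t = 'D_('D_(basis_vec a) c t) phi (c t).
  rewrite (deriveE _ dphi) (deriveE _ dc) deriveE; last exact: differentiable_comp.
  by rewrite diff_comp.
rewrite -(near_eq_derive _ E) D1 derive_rowE//.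
apply: eq_bigr => b' _; rewrite !mxE /c; congr (_ * _).
rewrite derive_mx; last exact: diff_derivable.
by rewrite mxE.
Qed.

Lemma contraction_chart (X : vector_field A) i t : V t -> dom i (sigma t) ->
  Defs.contraction dnu sigma t (X (chart_at A (sigma t)) (sigma t)) =
  dnu i (sigma t) * \det (col_mx (X i (sigma t)) (tang i t) : 'M[R]_m.+1).
Proof.
move=> Vt di; set j := chart_at A (sigma t); have dj : dom j (sigma t) by exact: chart_atP.
rewrite /Defs.contraction (_ : tangent A sigma t = tang j t)// (tang_change Vt di dj) (comp_change X di dj).
rewrite (density_change dnu di dj) -[in LHS]mul_col_mx det_mulmx -/j.
by rewrite mulrA mulrAC.
Qed.

Lemma contraction_continuous (X : vector_field A) t : V t ->
  {for t, continuous (fun t => Defs.contraction dnu sigma t (X (chart_at A (sigma t)) (sigma t)))}.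
Proof.
move=> Vt; have di := chart_atP A (sigma t); set i := chart_at A (sigma t) in di.
have nV : nbhs t V by exact: open_nbhs_nbhs.
have ni : nbhs t (sigma @^-1` dom i) by apply: (csigma Vt); exact: dom_nbhs.
have E : \near t, dnu i (sigma t) * \det (col_mx (X i (sigma t)) (tang i t) : 'M[R]_m.+1) =
    Defs.contraction dnu sigma t (X (chart_at A (sigma t)) (sigma t)).
  by apply: filterS2 nV ni => r Vr dr; exact/esym/(@contraction_chart X i r Vr dr).
apply: near_eq_for_continuous E _.
have cS (f : M -> R) : {for (crd i (sigma t)), continuous (f \o par i)} ->
    {for t, continuous (f \o sigma)}.
  move=> cf; apply: (@near_eq_for_continuous _ _ ((f \o par i) \o (crd i \o sigma))).
    by apply: filterS ni => r dr /=; rewrite crdK.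
  apply: continuous_comp; last exact: cf.
  by apply: continuous_comp; [exact: csigma|exact: crd_continuous].
have ci : (crd i @` dom i) (crd i (sigma t)) by exists (sigma t).
apply: for_continuousM.
  by apply: cS; exact: (Cinfty_continuous (density_smooth dnu i)).
apply: for_continuous_det => a b.
have [a' ->|a' ->] := @split_ordP 1 m a.
  have -> : (fun t => col_mx (X i (sigma t)) (tang i t) (lshift m a') b) =
      (fun t => X i (sigma t) ord0 b) by apply/funext => r; rewrite (@col_mxEu _ 1 m) ord1.
  by apply: (cS (fun x => X i x ord0 b)); exact: (Cinfty_continuous (comp_smooth X i b)).
have -> : (fun t => col_mx (X i (sigma t)) (tang i t) (rshift 1 a') b) =
  'D_(basis_vec a') (fun r => crd i (sigma r) ord0 b).
  by apply/funext => r; rewrite (@col_mxEd _ 1 m) mxE.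
by have [_ h] := C1sigma i b; exact: h.
Qed.

End Patch.

Lemma patch_boundary p t : cube t -> boundary Om (Defs.patch (b:=P) p t).
Proof. by move=> ct; rewrite -(patch_cover P); exists p => //; exists t. Qed.

Lemma patch_continuous p t : cube t -> {for t, continuous (Defs.patch (b:=P) p)}.
Proof. by have [V [_ cV c _]] := patch_C1 p => /cV; exact: c. Qed.

Lemma patch_within_continuous p (T : topologicalType) (f : M -> T) :
  {within boundary Om, continuous f} -> {within cube, continuous (f \o Defs.patch (b:=P) p)}.
Proof.
apply: within_continuous_comp; first exact: patch_continuous.
exact: patch_boundary.
Qed.

Lemma within_continuous_for (T U : topologicalType) (B : set T) (f : T -> U) :
  (forall x, B x -> {for x, continuous f}) -> {within B, continuous f}.
Proof. by move=> cf; apply: continuous_in_subspaceT => x /set_mem; exact: cf. Qed.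

Lemma boundary_int_eq (f g : M -> R) Y :
  (forall x, boundary Om x -> f x = g x) -> boundary_int P f Y = boundary_int P g Y.
Proof.
move=> fg; rewrite /boundary_int; apply: eq_bigr => p _; congr (_ * _).
by apply: eq_cube_int => t ct /=; rewrite fg//; exact: patch_boundary.
Qed.

Lemma boundary_int0 (f : M -> R) Y : (forall x, boundary Om x -> f x = 0) ->
  boundary_int P f Y = 0.
Proof.
move=> f0; rewrite (@boundary_int_eq _ (cst 0))// /boundary_int.
apply: big1 => p _; under [X in cube_int X]eq_fun do rewrite /= mul0r.
by rewrite cube_int0 mulr0.
Qed.

Lemma boundary_int_grad N (X : 'I_N -> vector_field A) (G w1 w2 : M -> R) a b :
  {within boundary Om, continuous w1} -> {within boundary Om, continuous w2} ->
  (forall k, {within boundary Om, continuous (lie (X k) G)}) ->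
  \sum_(k < N) boundary_int P (fun x => (a * w1 x + b * w2 x) * lie (X k) G x) (X k) =
  a * boundary_int P w1 (grad_field X G) + b * boundary_int P w2 (grad_field X G).
Proof.
move=> c1 c2 cG; rewrite /boundary_int exchange_big !mulr_sumr -big_split/=.
apply: eq_bigr => p _; rewrite -mulr_sumr.
rewrite [a * _]mulrCA [b * _]mulrCA -mulrDr; congr (_ * _).
pose gam k t := Defs.contraction dnu (Defs.patch (b:=P) p) t (X k (chart_at A (Defs.patch (b:=P) p t)) (Defs.patch (b:=P) p t)).
have cgam k : {within cube, continuous (gam k)}.
  apply: within_continuous_for => t ct; have [V [oV cV c C]] := patch_C1 p.
  by apply: contraction_continuous oV c C _ _ _; exact: cV.
have cM (f g : 'rV[R]_m -> R) := @within_continuousM _ _ cube f g.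
have cD (f g : 'rV[R]_m -> R) := @within_continuousD _ _ cube f g.
have cC (c : R) : {within cube, continuous (fun _ : 'rV[R]_m => c)}.
  by move=> t; exact: cvg_cst.
have cw1 := patch_within_continuous (p:=p) c1.
have cw2 := patch_within_continuous (p:=p) c2.
have cl k := patch_within_continuous (p:=p) (cG k).
pose F (w : M -> R) t := w (Defs.patch p t) * \sum_k lie (X k) G (Defs.patch p t) * gam k t.
have cF (w : M -> R) : {within cube, continuous (w \o Defs.patch p)} ->
    {within cube, continuous (F w)}.
  move=> cw; apply: (@cM) => //; apply: within_continuous_sum => k.
  exact: (cM _ _ (cl k) (cgam k)).
have E (w : M -> R) : cube_int (fun t => w (Defs.patch p t) * Defs.contraction dnu (Defs.patch p) t
    (grad_field X G (chart_at A (Defs.patch p t)) (Defs.patch p t))) = cube_int (F w).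
  by congr cube_int; apply/funext => t; rewrite /grad_field contraction_sum.
rewrite !E; have -> : a * cube_int (F w1) = cube_int (fun t => 0 + a * F w1 t).
  by rewrite cube_int_lin ?cube_int0 ?add0r//; exact: cF.
rewrite -cube_int_lin; last 2 first.
- by apply: (@cD) => //; apply: (@cM) => //; exact: cF.
- exact: cF.
rewrite -cube_int_sum; last first.
  move=> k; apply: (@cM); last exact: cgam.
  by apply: (@cM); [apply: (@cD); apply: (@cM)|exact: cl].
congr cube_int; apply/funext => t; rewrite add0r /F !mulrA -mulrDl mulr_sumr.
by apply: eq_bigr => k _; rewrite !mulrA.
Qed.

End Boundary.

(** * Integrability of continuous functions *)

Section BorelIntegrals.
Context {R : realType} {M : ptopologicalType} {nu : {measure set (borel M) -> \bar R}}.
Implicit Types (U K : set M) (f : M -> R).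

Lemma measurable_for_continuous U f : open U -> (forall x, U x -> {for x, continuous f}) ->
  measurable_fun (U : set (borel M)) (f : borel M -> R).
Proof.
move=> oU cf; apply: (measurability _ (measurable_realfun.RGenOpens.measurableE R)).
move=> _ [_ [a [b ->] <-]]; apply: open_measurable_borel.
rewrite openE => x [Ux fx].
have n1 : nbhs x U by exact: open_nbhs_nbhs.
have n2 : nbhs x (f @^-1` `]a, b[%classic).
  by apply: (cf x Ux); apply: open_nbhs_nbhs; split => //; exact: interval_open.
exact: filterI n1 n2.
Qed.

Lemma measurable_fun_setD1 d (T : measurableType d) (U : set (borel M)) y (f : borel M -> T) :
  measurable U -> measurable [set y] -> measurable_fun (U `\ y) f -> measurable_fun U f.
Proof.
move=> mU my mf; have [Uy|Uy] := pselect (U y); last by rewrite -(not_setD1 Uy).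
rewrite -(setD1K Uy); apply/measurable_funU => //; first exact: measurableD.
by split => //; exact: measurable_fun_set1.
Qed.

Lemma bounded_compact_support U K f : compact K -> (forall x, K x -> {for x, continuous f}) ->
  (forall x, U x -> ~ K x -> f x = 0) -> exists C, forall x, U x -> `|f x| <= C.
Proof.
move=> cK cf f0.
have [K0|K0] := pselect (K !=set0); last first.
  by exists 0 => x Ux; rewrite f0 ?normr0// => Kx; apply: K0; exists x.
have cn : {within K, continuous (fun x => `|f x|)}.
  apply: continuous_in_subspaceT => x /set_mem Kx.
  by apply: continuous_comp; [exact: cf|exact: norm_continuous].
have [c _ hc] := compact_EVT_max K0 cK cn.
exists `|f c| => x Ux; have [Kx|Kx] := pselect (K x); first by apply: hc; rewrite inE.
by rewrite f0// normr0.
Qed.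

Lemma integrable_bounded (U : set (borel M)) (f : borel M -> R) : measurable U -> (nu U < +oo)%E ->
  measurable_fun U f -> (exists C, forall x, U x -> `|f x| <= C) ->
  nu.-integrable U (EFin \o f).
Proof.
move=> mU fU mf [C hC]; apply: measurable_bounded_integrable => //.
exists C; split; first exact: num_real.
by move=> y Cy x Ux; apply: le_trans (hC x Ux) (ltW Cy).
Qed.

Lemma integrable_compact_support U K f : open U -> (nu U < +oo)%E -> compact K -> K `<=` U ->
  (forall x, U x -> {for x, continuous f}) -> (forall x, U x -> ~ K x -> f x = 0) ->
  nu.-integrable (U : set (borel M)) (EFin \o (f : borel M -> R)).
Proof.
move=> oU fU cK KU cf f0; apply: integrable_bounded => //.
- exact: open_measurable_borel.
- exact: measurable_for_continuous.
- by apply: bounded_compact_support cK _ f0 => x /KU; exact: cf.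
Qed.

Lemma Rintegral_sum (U : set (borel M)) (I : Type) (r : seq I) (F : I -> borel M -> R) :
  measurable U -> (forall i, nu.-integrable U (EFin \o F i)) ->
  nu.-integrable U (EFin \o (fun x => \sum_(i <- r) F i x)) /\
  \int[nu]_(x in U) (\sum_(i <- r) F i x) = \sum_(i <- r) \int[nu]_(x in U) F i x.
Proof.
move=> mU iF; elim: r => [|i r [IHi IH]].
  have -> : (fun x => \sum_(i <- [::]) F i x) = cst 0 by apply/funext => x; rewrite big_nil.
  by split; [exact: integrable0|rewrite big_nil Rintegral_cst// mul0r].
have -> : (fun x => \sum_(j <- i :: r) F j x) = (fun x => F i x + \sum_(j <- r) F j x).
  by apply/funext => x; rewrite big_cons.
split; last by rewrite RintegralD// IH big_cons.
by have := integrableD mU (iF i) IHi; apply: eq_integrable.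
Qed.

Lemma Rintegral_subset (U V : set (borel M)) (f : borel M -> R) : U `<=` V ->
  (forall x, V x -> ~ U x -> f x = 0) ->
  \int[nu]_(x in V) f x = \int[nu]_(x in U) f x.
Proof.
move=> UV f0; rewrite Rintegral_mkcond [RHS]Rintegral_mkcond.
congr fine; apply: eq_integral => x _; congr EFin; rewrite !patchE.
case: ifPn => [/set_mem Vx|nV]; case: ifPn => [/set_mem Ux|nU] //.
  by apply: f0 => //; move/negP: nU; rewrite inE.
by move/negP: nV; rewrite inE => /(_ (UV _ Ux)).
Qed.

End BorelIntegrals.

(** * Green formula on an admissible domain *)

Lemma continuous_integral0 {R : realType} {n : nat} {M : ptopologicalType}
    {A : manifold R n M} {dnu : volume_form A} {nu : {measure set (borel M) -> \bar R}}
    (U : set M) (F : M -> R) x :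
  volume_measure dnu nu -> open U -> (forall x, U x -> {for x, continuous F}) ->
  (forall x, U x -> 0 <= F x) -> nu.-integrable U (EFin \o F) ->
  \int[nu]_(x in U) F x = 0 -> U x -> F x = 0.
Proof.
move=> hnu oU cF F0 iF intF Ux; apply/eqP/negPn/negP => Fx.
have {Fx}Fx : 0 < F x by rewrite lt_neqAle eq_sym Fx F0.
have mU : measurable (U : set (borel M)) by exact: open_measurable_borel.
pose W := (U `&` [set z | F x / 2 < F z])^°.
have Wx : W x.
  apply: filterI; first exact: open_nbhs_nbhs.
  have := cF x Ux; move/(@cvgr_gt _ _ _ _ _); apply.
  by rewrite ltr_pdivrMr// ltr_pMr// ltr1n.
have c0 : 0 < F x / 2 by rewrite divr_gt0.
have mF := measurable_int _ iF.
have mW : measurable (W : set (borel M)) by apply: open_measurable_borel; exact: open_interior.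
have WU : W `<=` U by move=> z /interior_subset[].
have nuW := @nu_open_gt0 _ _ _ _ _ _ hnu W x (@open_interior _ _) Wx.
have : ((F x / 2)%:E * nu W <= 0)%E.
  have <- : (\int[nu]_(x in U) (EFin \o F) x = 0)%E.
    by rewrite -[LHS]fineK ?integrable_fin_num//; congr EFin.
  apply: (@le_trans _ _ (\int[nu]_(x in W) (EFin \o F) x)%E); last first.
    by apply: ge0_subset_integral => // z Uz; rewrite /= lee_fin F0.
  rewrite -integral_cst//; apply: ge0_le_integral => //.
  - by move=> z _; rewrite lee_fin ltW.
  - exact: measurable_funS mF.
  - by move=> z /interior_subset[_ /ltW]; rewrite /= lee_fin.
by rewrite pmule_rle0 ?lte_fin// leNgt nuW.
Qed.

Section Harmonic.
Context {R : realType} {m : nat} {M : ptopologicalType} {A : manifold R m.+1 M}.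
Context {dnu : volume_form A} {nu : {measure set (borel M) -> \bar R}}.
Context {N : nat} {X : 'I_N -> vector_field A} {Om : set M} {P : boundary_patches dnu Om}.
Hypothesis hnu : volume_measure dnu nu.
Hypothesis hOm : admissible_domain X nu P.
Hypothesis flOm : flows X Om.
Implicit Types (U V K : set M) (f g phi : M -> R).

Lemma admissible_open : open Om. Proof. by case: hOm. Qed.
Let oOm := admissible_open.

Lemma admissible_finite : (nu Om < +oo)%E.
Proof.
have [_ cOm _ _] := hOm; have mO : measurable (Om : set (borel M)) by exact: open_measurable_borel.
have mC : measurable (closure Om : set (borel M)).
  by apply: closed_measurable_borel; exact: closed_closure.
apply: le_lt_trans (nu_compact_finite hnu cOm).
by apply: le_measure; rewrite ?inE//; exact: subset_closure.
Qed.
Let fOm := admissible_finite.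

Let mOm : measurable (Om : set (borel M)).
Proof. exact: open_measurable_borel. Qed.

Let K_open K : compact K -> open (~` K).
Proof. by move=> cK; rewrite openC; apply: compact_closed => //; exact: man_hausdorff A. Qed.

Let nK_near K f x : compact K -> (forall x, ~ K x -> f x = 0) -> ~ K x -> \near x, f x = 0.
Proof. by move=> cK f0 Kx; apply: filterS (open_nbhs_nbhs (conj (K_open cK) Kx)). Qed.

Let nK_continuous K f x : compact K -> (forall x, ~ K x -> f x = 0) -> ~ K x ->
  {for x, continuous f}.
Proof.
move=> cK f0 Kx; apply: (@near_eq_for_continuous _ _ (cst 0)); last exact: cvg_cst.
by apply: filterS (nK_near cK f0 Kx) => z ->.
Qed.

Lemma boundary_notin x : boundary Om x -> ~ Om x.
Proof. by case=> _; rewrite (interior_id _).1. Qed.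

Lemma C1_compact_support V K f : open V -> V `<=` Om -> compact K -> K `<=` V ->
  (forall x, ~ K x -> f x = 0) -> C1 X V f -> C1 X Om f.
Proof.
move=> oV VO cK KV f0 CV; apply: (@C1_sub _ _ _ _ _ _ (V `|` (Om `&` ~` K))).
  by move=> x Ox; have [/KV|] := pselect (K x); [left|right].
apply: C1_setU => //; apply: (@C1_eq _ _ _ _ _ _ _ (cst 0)).
- by apply: openI => //; exact: K_open.
- by move=> x [_ /f0].
- apply: C1_cst; first by apply: openI => //; exact: K_open.
  by move=> k x [Ox _]; exact: flOm.
Qed.

Lemma integral_divergence0 K (f : 'I_N -> M -> R) : compact K -> K `<=` Om ->
  (forall k x, ~ K x -> f k x = 0) -> (forall k, C1 X Om (f k)) ->
  \int[nu]_(x in Om) (\sum_k lie (X k) (f k) x) = 0.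
Proof.
move=> cK KO f0 Cf; have [_ _ _ div] := hOm.
have intf k : nu.-integrable Om (EFin \o lie (X k) (f k)).
  apply: (@integrable_compact_support _ _ _ Om K) => //.
  - by move=> x Ox; exact: C1_lie_continuous (Cf k) Ox.
  - by move=> x _ Kx; apply: lie_eq0; exact: (nK_near cK (f0 k) Kx).
have [_ ->] := Rintegral_sum (index_enum _) mOm intf.
rewrite div//.
- apply: big1 => k _; apply: boundary_int0 => x /boundary_notin Ox.
  by apply: f0 => /KO.
- move=> k; apply: within_continuous_for => x _.
  have [Ox|Ox] := pselect (Om x); first exact: C1_continuous (Cf k) Ox.
  by apply: (nK_continuous cK (f0 k)) => /KO.
Qed.

Lemma green V K g phi : open V -> V `<=` Om -> C2 X V g -> smooth_on A Om phi ->
  compact K -> K `<=` V -> (forall x, ~ K x -> phi x = 0) ->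
  \int[nu]_(x in Om) (g x * sumsq X phi x) = \int[nu]_(x in Om) (phi x * sumsq X g x).
Proof.
move=> oV VO [C1g C2g] sphi cK KV phi0.
have flk k x : Om x -> exists c, flow_line (X k) x c by exact: flOm.
have sl k : smooth_on A Om (lie (X k) phi) by apply: smooth_on_lie => //; exact: flk.
have sll k : smooth_on A Om (lie (X k) (lie (X k) phi)) by apply: smooth_on_lie => //; exact: flk.
have C1s (h : M -> R) : smooth_on A Om h -> C1 X Om h by move=> sh; exact: smooth_on_C1.
have l0 k x : ~ K x -> lie (X k) phi x = 0 by move=> Kx; apply: lie_eq0; exact: nK_near Kx.
have ll0 k x : ~ K x -> lie (X k) (lie (X k) phi) x = 0.
  by move=> Kx; apply: lie_eq0; exact: (nK_near cK (l0 k) Kx).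
have s0 x : ~ K x -> sumsq X phi x = 0 by move=> Kx; rewrite /sumsq big1// => k _; exact: ll0.
pose f k := (g \* lie (X k) phi) \+ ((cst (-1) \* phi) \* lie (X k) g).
have CVphi := C1_sub VO (C1s _ sphi).
have CVl k := C1_sub VO (C1s _ (sl k)).
have Cm1 : C1 X V (cst (-1) \* phi).
  by apply: C1_M => //; apply: C1_cst => // k x /VO; exact: flOm.
have CVf k : C1 X V (f k) by apply: C1_D => //; apply: C1_M.
have f0 k x : ~ K x -> f k x = 0 by move=> Kx; rewrite /f/= l0// phi0// !mulr0 mul0r addr0.
have Cf k : C1 X Om (f k) by exact: C1_compact_support (oV) VO cK KV (f0 k) (CVf k).
have lf k x : lie (X k) (f k) x =
    g x * lie (X k) (lie (X k) phi) x - phi x * lie (X k) (lie (X k) g) x.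
  have [Vx|Vx] := pselect (V x); last first.
    have Kx : ~ K x by move/KV.
    rewrite lie_eq0 ?ll0 ?phi0 ?mulr0 ?mul0r ?subr0//.
    exact: (nK_near cK (f0 k) Kx).
  rewrite (lie_D _ (C1_M oV C1g (CVl k)) (C1_M oV Cm1 (C2g k)) Vx).
  rewrite (lie_M _ C1g (CVl k) Vx) (lie_M _ Cm1 (C2g k) Vx) (lie_M _ _ CVphi Vx); last first.
    by apply: C1_cst => // k' z /VO; exact: flOm.
  rewrite (lieE (is_lie_cst _ _)); last exact: flk k x (VO x Vx).
  by rewrite /=; ring.
have ctn0 (h : M -> R) : (forall x, V x -> {for x, continuous h}) -> (forall x, ~ K x -> h x = 0) ->
    nu.-integrable Om (EFin \o h).
  move=> ch h0; apply: (@integrable_compact_support _ _ _ Om K) => //.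
  - by apply: subset_trans KV VO.
  - move=> x Ox; have [/KV|Kx] := pselect (K x); first exact: ch.
    exact: nK_continuous h0 Kx.
  - by move=> x _; exact: h0.
have i1 : nu.-integrable Om (EFin \o (fun x => g x * sumsq X phi x)).
  apply: ctn0; last by move=> x Kx; rewrite s0// mulr0.
  move=> x Vx; apply: for_continuousM; first exact: C1_continuous C1g Vx.
  apply: for_continuous_sum => k; apply: smooth_on_continuous oOm (sll k) _; exact: VO.
have i2 : nu.-integrable Om (EFin \o (fun x => phi x * sumsq X g x)).
  apply: ctn0; last by move=> x Kx; rewrite phi0// mul0r.
  move=> x Vx; apply: for_continuousM; first exact: C1_continuous CVphi Vx.
  by apply: for_continuous_sum => k; exact: C1_lie_continuous (C2g k) Vx.
have := integral_divergence0 cK (subset_trans KV VO) f0 Cf.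
under eq_Rintegral => x _.
  rewrite (eq_bigr (fun k => g x * lie (X k) (lie (X k) phi) x - phi x * lie (X k) (lie (X k) g) x)) => [|k _]; last exact: lf.
  rewrite sumrB -!mulr_sumr; over.
by rewrite RintegralB// => /subr0_eq.
Qed.

Lemma test_smooth_on U phi : test_function A U phi -> smooth_on A Om phi.
Proof. by case=> sphi _ _; exact: smooth_smooth_on. Qed.

Lemma notin_support f x : ~ Defs.support f x -> f x = 0.
Proof. by move=> nx; apply/eqP/negPn/negP => fx; apply: nx; exact: subset_closure. Qed.

Lemma transpose_sumsq_test phi : test_function A Om phi ->
  transpose_sumsq X nu phi (fun x => if x \in Om then sumsq X phi x else 0).
Proof.
move=> tphi; have [sphi cK KO] := tphi; set K := Defs.support phi in cK KO.
have sO := test_smooth_on tphi.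
have flk k x : Om x -> exists c, flow_line (X k) x c by exact: flOm.
have phi0 x : ~ K x -> phi x = 0 by exact: notin_support.
have l0 k x : ~ K x -> lie (X k) phi x = 0 by move=> Kx; apply: lie_eq0; exact: nK_near Kx.
have s0 x : ~ K x -> sumsq X phi x = 0.
  move=> Kx; rewrite /sumsq big1// => k _; apply: lie_eq0.
  exact: (nK_near cK (l0 k) Kx).
set h := fun x => _; have h0 x : ~ K x -> h x = 0.
  by move=> Kx; rewrite /h; case: ifP => // _; exact: s0.
split => //.
- move=> x; have [/KO Ox|Kx] := pselect (K x); last first.
    exact: nK_continuous h0 Kx.
  apply: (@near_eq_for_continuous _ _ (sumsq X phi)).
    by apply: open_near_eq Ox => // z Oz; rewrite /h mem_set.
  apply: for_continuous_sum => k; apply: (@smooth_on_continuous _ _ _ A Om) => //.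
  by apply: smooth_on_lie => //; [apply: smooth_on_lie => //|]; exact: flk.
- move=> psi tpsi; have spsi : smooth_on A Om psi by case: tpsi => s _ _; exact: smooth_smooth_on.
  have C1s (g : M -> R) : smooth_on A Om g -> C1 X Om g by move=> sh; exact: smooth_on_C1.
  have C2psi : C2 X Om psi.
    by split=> [|k]; apply: C1s => //; apply: smooth_on_lie => //; exact: flk.
  rewrite (@Rintegral_subset _ _ _ Om)//; last first.
    by move=> x _ Ox; rewrite h0 ?mulr0// => /KO.
  rewrite (@Rintegral_subset _ _ _ Om setT (fun x => sumsq X psi x * phi x))//; last first.
    by move=> x _ Ox; rewrite phi0 ?mulr0// => /KO.
  have := green oOm (fun _ => id) C2psi sO cK KO phi0.
  under [RHS]eq_Rintegral do rewrite mulrC.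
  by move=> <-; apply: eq_Rintegral => x Ox; rewrite /h Ox.
Qed.

Lemma sumsq_fundamental y T G : assumption_A X nu T y G -> Om `<=` T ->
  forall x, Om x -> x <> y -> sumsq X G x = 0.
Proof.
move=> [oT Ty [C1G C2G] [_ sG]] OT x0 Ox0 xy.
have oy : open (~` [set y]).
  rewrite openC; apply: accessible_closed_set1; apply: hausdorff_accessible; exact: man_hausdorff A.
pose V := Om `&` ~` [set y]; have oV : open V by exact: openI.
have VT : V `<=` T `\ y by move=> x [/OT].
have VO : V `<=` Om by move=> x [].
have CG : C2 X V G by split=> [|k]; [exact: C1_sub C1G|exact: C1_sub (C2G k)].
have cLG x : V x -> {for x, continuous (sumsq X G)}.
  by move=> Vx; have [_ h] := CG; apply: for_continuous_sum => k; exact: C1_lie_continuous (h k) Vx.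
have key phi : test_function A V phi -> \int[nu]_(x in Om) (phi x * sumsq X G x) = 0.
  move=> tphi; have [sphi cK KV] := tphi; set K := Defs.support phi in cK KV.
  have phi0 x : ~ K x -> phi x = 0 by exact: notin_support.
  have tO : test_function A Om phi by split => //; exact: subset_trans KV VO.
  have tT : test_function A T phi by split => //; move=> x /KV/VO/OT.
  rewrite -(green oV VO CG (test_smooth_on tO) cK KV phi0).
  have := sG _ _ tT (transpose_sumsq_test tO).
  rewrite phi0 => [/eqP|/KV[_]]; last exact.
  rewrite oppr_eq0 => /eqP <-; rewrite [RHS](@Rintegral_subset _ _ _ Om)//.
    by apply: eq_Rintegral => x Ox; rewrite Ox.
  by move=> x _ Ox; rewrite memNset ?mulr0.
apply/eqP/negPn/negP => LG0.
pose s := Num.sg (sumsq X G x0).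
have Vx0 : V x0 by [].
have sL0 : 0 < s * sumsq X G x0 by rewrite -normrEsg normr_gt0.
have cs x : V x -> {for x, continuous (fun x => s * sumsq X G x)}.
  by move=> Vx; apply: for_continuousZ; exact: cLG.
pose W := (V `&` [set x | 0 < s * sumsq X G x])^°.
have Wx0 : W x0.
  apply: filterI; first exact: open_nbhs_nbhs.
  by have := cs x0 Vx0; move/(@cvgr_gt _ _ _ _ _); apply.
have WV x : W x -> V x /\ 0 < s * sumsq X G x by move=> /interior_subset[].
have [phi [tphi phi0 phix0]] := @exists_test_function _ _ _ A _ _ (@open_interior _ _) Wx0.
have [sphi cK KW] := tphi; set K := Defs.support phi in cK KW.
have tV : test_function A V phi by split => // x /KW/WV[].
pose F x := phi x * (s * sumsq X G x).
have F0 x : Om x -> ~ K x -> F x = 0 by move=> _ Kx; rewrite /F notin_support// mul0r.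
have KV : K `<=` V by move=> x /KW/WV[].
have cF x : Om x -> {for x, continuous F}.
  move=> Ox; have [/KV Vx|Kx] := pselect (K x).
    apply: for_continuousM; last exact: cs.
    apply: (@smooth_on_continuous _ _ _ A Om) => //; exact: smooth_smooth_on.
  by apply: (nK_continuous cK _ Kx) => z Kz; rewrite /F notin_support// mul0r.
have iF := integrable_compact_support oOm fOm cK (subset_trans KV VO) cF F0.
have F_ge0 x : Om x -> 0 <= F x.
  move=> Ox; have [/KW/WV[_ /ltW h]|Kx] := pselect (K x); last by rewrite F0.
  by rewrite mulr_ge0.
have intF : \int[nu]_(x in Om) F x = 0.
  have E : F = (fun x => s * (phi x * sumsq X G x)).
    by apply/funext => x; rewrite /F mulrCA.
  rewrite E RintegralZl//; first by rewrite key// mulr0.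
  apply: (@integrable_compact_support _ _ _ Om K) => //.
  - exact: subset_trans KV VO.
  - move=> x Ox; have [/KV Vx|Kx] := pselect (K x).
      apply: for_continuousM; last exact: cLG.
      by apply: (@smooth_on_continuous _ _ _ A Om) => //; exact: smooth_smooth_on.
    by apply: (nK_continuous cK _ Kx) => z Kz; rewrite notin_support// mul0r.
  - by move=> x _ Kx; rewrite notin_support// mul0r.
have := continuous_integral0 hnu oOm cF F_ge0 iF intF Ox0.
by apply/eqP; rewrite gt_eqF// /F mulr_gt0.
Qed.
End Harmonic.

(** * Truncations of the logarithmic profile *)

Section RadialProfile.
Context {R : realType}.
Variables (beta r : R).
Hypotheses (hbeta : 2 < beta) (r0 : 0 < r).
Implicit Types (t : R).

Let kap : R := 1 / (2 * (beta - 2)).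

Definition ell t : R := ln (r / t `^ (1 / (2 - beta))).

Lemma ellE t : 0 < t -> ell t = ln r + 2 * kap * ln t.
Proof.
move=> t0; rewrite /ell ln_div ?posrE ?powR_gt0// ln_powR /kap.
have h1 : beta - 2 != 0 by rewrite gt_eqF// subr_gt0.
have h2 : 2 - beta != 0 by rewrite -opprB oppr_eq0.
by field; rewrite h1 h2.
Qed.

Lemma is_derive_ell t : 0 < t -> is_derive t (1 : R) ell (2 * kap / t).
Proof.
move=> t0; have E : \forall s \near t, ln r + 2 * kap * ln s = ell s.
  by near=> s; rewrite ellE//; near: s; exact: lt_nbhsr.
apply: near_eq_is_derive E _.
have d0 := is_derive1_ln t0.
have d1 := is_deriveZ (2 * kap) d0.
have d2 := is_deriveD (is_derive_cst (ln r) t (1:R)) d1.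
by apply: (is_derive_eq d2); rewrite add0r.
Unshelve. all: by end_near. Qed.

Lemma is_derive_inv t : 0 < t -> is_derive t (1 : R) (fun s => s^-1) (- t ^- 2).
Proof.
move=> t0; have tn0 : id t != 0 by rewrite gt_eqF.
by apply: (is_derive_eq (@is_deriveV _ id t 1 1 tn0 _)); rewrite [_ *: _]mulr1.
Qed.

Definition coefa t : R := t^-1 * (1 / 2 + kap * (ell t)^-1).
Definition coefa' t : R :=
  - t ^- 2 * (1 / 2 + kap * (ell t)^-1) - 2 * kap ^+ 2 * t ^- 2 * (ell t) ^- 2.

Lemma is_derive_coefa t : 0 < t -> 0 < ell t -> is_derive t (1 : R) coefa (coefa' t).
Proof.
move=> t0 l0; have ln0 : ell t != 0 by rewrite gt_eqF.
have dV := @is_deriveV _ ell t _ 1 ln0 (is_derive_ell t0).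
have d2 := is_deriveD (is_derive_cst (1 / 2 : R) t (1:R)) (is_deriveZ kap dV).
have d3 := is_deriveM (is_derive_inv t0) d2.
apply: (is_derive_eq d3); rewrite /coefa' /GRing.scale/= -[(_ + _) t]/(1 / 2 + kap * (ell t)^-1).
have tn0 : t != 0 by rewrite gt_eqF.
by field; rewrite ln0 tn0.
Qed.

Lemma coefa_identity t : 0 < t -> 0 < ell t ->
  - coefa' t - coefa t ^+ 2 = (1 / 4 + kap ^+ 2 * (ell t) ^- 2) * t ^- 2.
Proof.
move=> t0 l0; have ln0 : ell t != 0 by rewrite gt_eqF.
have tn0 : t != 0 by rewrite gt_eqF.
by rewrite /coefa' /coefa; field; rewrite ln0 tn0.
Qed.

Lemma coefa_ge0 t : 0 < t -> 0 < ell t -> 0 <= coefa t.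
Proof.
move=> t0 l0; rewrite mulr_ge0 ?invr_ge0 ?(ltW t0)// addr_ge0//.
rewrite divr_ge0 ?(ltW l0)// /kap divr_ge0// mulr_ge0// subr_ge0; exact: ltW.
Qed.

Lemma continuous_inv t : 0 < t -> {for t, continuous (fun s : R => s^-1)}.
Proof. by move=> t0; apply: inv_continuous; rewrite gt_eqF. Qed.

Lemma continuous_ell t : 0 < t -> {for t, continuous ell}.
Proof.
by move=> t0; apply/differentiable_continuous/derivable1_diffP; case: (is_derive_ell t0).
Qed.

Lemma continuous_coefa t : 0 < t -> 0 < ell t -> {for t, continuous coefa}.
Proof.
by move=> t0 l0; apply/differentiable_continuous/derivable1_diffP; case: (is_derive_coefa t0 l0).
Qed.

Lemma continuous_ellV t : 0 < t -> 0 < ell t -> {for t, continuous (fun s => (ell s)^-1)}.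
Proof.
move=> t0 l0; apply: (@continuous_comp _ _ _ ell (fun s => s^-1)); first exact: continuous_ell.
exact: continuous_inv.
Qed.

Lemma for_continuous_sqr (T : topologicalType) (f : T -> R) x :
  {for x, continuous f} -> {for x, continuous (fun s => f s ^+ 2)}.
Proof. by move=> cf; exact: for_continuousM. Qed.

Lemma continuous_coefa' t : 0 < t -> 0 < ell t -> {for t, continuous coefa'}.
Proof.
move=> t0 l0.
pose g s := (-1 : R) * ((s^-1) ^+ 2 * (1 / 2 + kap * (ell s)^-1)) +
  (- 2 * kap ^+ 2) * ((s^-1) ^+ 2 * ((ell s)^-1) ^+ 2).
have -> : coefa' = g by apply/funext => s; rewrite /g /coefa' !exprVn; ring.
have c1 := for_continuous_sqr (continuous_inv t0).
have c2 := continuous_ellV t0 l0.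
apply: for_continuousD; apply: for_continuousZ; apply: for_continuousM => //.
  by apply: for_continuousD; [exact: cvg_cst|exact: for_continuousZ].
exact: for_continuous_sqr.
Qed.

(* The cutoff vanishes for t >= n and equals 1 for t <= n / 2. *)
Definition cutoff (n : nat) t : R := step (n%:R * t^-1 - 1).
Definition cutoff' (n : nat) t : R := step' (n%:R * t^-1 - 1) * (- n%:R * t ^- 2).

Lemma is_derive_cutoff n t : 0 < t -> is_derive t (1 : R) (cutoff n) (cutoff' n t).
Proof.
move=> t0; have d1 : is_derive t (1 : R) (fun s => n%:R * s^-1 - 1) (- n%:R * t ^- 2).
  have := is_deriveB (is_deriveZ n%:R (is_derive_inv t0)) (is_derive_cst (1:R) t (1:R)).
  by move=> d; apply: (is_derive_eq d); rewrite subr0 /GRing.scale/= mulrN mulNr.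
exact: (@is_derive1_comp R step (fun s => n%:R * s^-1 - 1) t _ _ (is_derive_step _) d1).
Qed.

Lemma cutoff'_le0 n t : cutoff' n t <= 0.
Proof.
rewrite /cutoff' mulNr mulrN oppr_le0 mulr_ge0 ?step'_ge0// mulr_ge0//.
by rewrite invr_ge0 sqr_ge0.
Qed.

Lemma continuous_cutoff' n t : 0 < t -> {for t, continuous (cutoff' n)}.
Proof.
move=> t0; have c1 := continuous_inv t0.
have -> : cutoff' n = (fun s => step' (n%:R * s^-1 + (-1)) * ((- n%:R) * (s^-1) ^+ 2)).
  by apply/funext => s; rewrite /cutoff' exprVn.
apply: for_continuousM; last by apply: for_continuousZ; exact: for_continuous_sqr.
have c2 : {for t, continuous (fun s : R => n%:R * s^-1 + (-1) : R)}.
  by apply: for_continuousD; [exact: for_continuousZ|exact: cvg_cst].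
exact: (continuous_comp c2 (@continuous_step' R _)).
Qed.

Definition profile n t : R := cutoff n t * coefa t.
Definition profile' n t : R := cutoff n t * coefa' t + coefa t * cutoff' n t.

Lemma is_derive_profile n t : 0 < t -> 0 < ell t ->
  is_derive t (1 : R) (profile n) (profile' n t).
Proof.
move=> t0 l0; have := is_deriveM (is_derive_cutoff n t0) (is_derive_coefa t0 l0).
by move=> d; exact: (is_derive_eq d).
Qed.

Lemma continuous_cutoff n t : 0 < t -> {for t, continuous (cutoff n)}.
Proof.
by move=> t0; apply/differentiable_continuous/derivable1_diffP; case: (is_derive_cutoff n t0).
Qed.

Lemma continuous_profile' n t : 0 < t -> 0 < ell t -> {for t, continuous (profile' n)}.
Proof.
move=> t0 l0; apply: for_continuousD; apply: for_continuousM.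
- exact: continuous_cutoff.
- exact: continuous_coefa'.
- exact: continuous_coefa.
- exact: continuous_cutoff'.
Qed.

End RadialProfile.

(** * The logarithmic Hardy inequality *)

Lemma bounded_within (R : realType) (T : topologicalType) (K : set T) (f : T -> R) :
  compact K -> {within K, continuous f} -> exists2 C, 0 <= C & forall x, K x -> `|f x| <= C.
Proof.
move=> cK cf; have [K0|K0] := pselect (K !=set0); last first.
  by exists 0 => // x Kx; exfalso; apply: K0; exists x.
have cn : {within K, continuous (fun x => `|f x|)}.
  move=> x; apply: (@continuous_comp (subspace K) _ _ f (fun z => `|z|)); first exact: cf.
  exact: norm_continuous.
have [c _ hc] := compact_EVT_max K0 cK cn.
by exists `|f c| => // x Kx; apply: hc; rewrite inE.
Qed.

Section Hardy.
Context {R : realType} {m : nat} {M : ptopologicalType} {A : manifold R m.+1 M}.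
Context {dnu : volume_form A} {nu : {measure set (borel M) -> \bar R}}.
Context {N : nat} {X : 'I_N -> vector_field A} {Om : set M} {P : boundary_patches dnu Om}.
Hypothesis hnu : volume_measure dnu nu.
Hypothesis hOm : admissible_domain X nu P.
Variables (y : M) (T : set M) (G : M -> R).
Hypothesis hG : assumption_Aplus X nu T y G.
Hypothesis hOmT : closure Om `<=` T.
Hypothesis hy : ~ boundary Om y.
Variables (v w : M -> R).
Hypotheses (C1v : C1 X Om v) (C1w : C1 X Om w).
Hypotheses (cv : {within closure Om, continuous v}) (cw : {within closure Om, continuous w}).
Variables (beta r : R).
Hypothesis hbeta : 2 < beta.
Hypothesis hr : forall x, Om x -> x <> y -> expR 1 * G x `^ (1 / (2 - beta)) <= r.

Let kap : R := 1 / (2 * (beta - 2)).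
Let oOm : open Om := admissible_open hOm.
Let flOm : flows X Om := C1_flows C1v.
Let L x := ell beta r (G x).

Let mOm : measurable (Om : set (borel M)).
Proof. exact: open_measurable_borel. Qed.

Let oy : open (~` [set y]).
Proof.
rewrite openC; apply: accessible_closed_set1; apply: hausdorff_accessible; exact: man_hausdorff A.
Qed.

Let oT : open T. Proof. by case: hG => -[]. Qed.

Let OmT : Om `<=` T. Proof. by move=> x Ox; apply: hOmT; exact: subset_closure. Qed.

Let oTy : open (T `\ y). Proof. exact: openI. Qed.

Let G_gt0 x : (T `\ y) x -> 0 < G x. Proof. by case: hG => _ h _; exact: h. Qed.

Let C1G : C1 X (T `\ y) G. Proof. by case: hG => -[_ _ [h _] _]. Qed.

Let C1lG k : C1 X (T `\ y) (lie (X k) G). Proof. by case: hG => -[_ _ [_ h] _] _ _; exact: h. Qed.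

Let LG0 x : Om x -> x <> y -> sumsq X G x = 0.
Proof. by case: hG => hA _ _; apply: (sumsq_fundamental hnu hOm flOm hA) OmT _. Qed.

Let V := (T `\ y) `&` [set x | 0 < r /\ 0 < L x].

Let cG x : (T `\ y) x -> {for x, continuous G}.
Proof. by move=> Tx; exact: C1_continuous C1G Tx. Qed.

Let oV : open V.
Proof.
have [r0|r0] := ltP 0 r; last first.
  have -> : V = set0 by apply/seteqP; split => // x [_ [/lt_geF]]; rewrite r0.
  exact: open0.
rewrite openE => x [Tx [_ Lx]]; apply: filterI; first exact: open_nbhs_nbhs.
have cL : {for x, continuous L}.
  apply: (@continuous_comp _ _ _ G (ell beta r)); first exact: cG.
  by apply: continuous_ell => //; exact: G_gt0.
have := cL; move/(@cvgr_gt _ _ _ _ _)/(_ _ Lx).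
by apply: filterS => z Lz.
Qed.

Let VP x : V x -> [/\ (T `\ y) x, 0 < G x, 0 < r & 0 < L x].
Proof. by move=> [Tx [? ?]]; split => //; exact: G_gt0. Qed.

Lemma closure_radius x : closure Om x -> x <> y -> expR 1 * G x `^ (1 / (2 - beta)) <= r.
Proof.
move=> cx xy; have Tx : (T `\ y) x by split => //; exact: hOmT.
rewrite leNgt; apply/negP => rlt.
have cd : {for x, continuous (fun z => expR 1 * G z `^ (1 / (2 - beta)))}.
  apply: for_continuousZ.
  apply: (@continuous_comp _ _ _ G (fun t => t `^ (1 / (2 - beta)))); first exact: cG.
  apply/differentiable_continuous/derivable1_diffP.
  by case: (is_derive1_powR (1 / (2 - beta)) (G_gt0 Tx)).
have n1 : nbhs x [set z | r < expR 1 * G z `^ (1 / (2 - beta))].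
  by have := cd; move/(@cvgr_gt _ _ _ _ _)/(_ _ rlt).
have n2 : nbhs x (~` [set y]) by exact: open_nbhs_nbhs.
have [z [Oz [zr zy]]] := cx _ (filterI n1 n2).
by move: zr; rewrite /= ltNge hr.
Qed.

Let closure_V x : closure Om x -> x <> y -> V x.
Proof.
move=> cx xy; have Tx : (T `\ y) x by split => //; exact: hOmT.
have h := closure_radius cx xy; have Gx := G_gt0 Tx.
have d0 : 0 < G x `^ (1 / (2 - beta)) by exact: powR_gt0.
have r0 : 0 < r by apply: lt_le_trans h; rewrite mulr_gt0 ?expR_gt0.
split => //; split => //; rewrite /L /ell ln_gt0//.
rewrite ltr_pdivlMr//; apply: lt_le_trans h.
by rewrite ltr_pM2r// expR_gt1.
Qed.

Let Om_V x : Om x -> x <> y -> V x.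
Proof. by move=> Ox; apply: closure_V; exact: subset_closure. Qed.

Lemma radius_facts x : Om x -> x <> y -> [/\ 0 < G x, 0 < r & 0 < ell beta r (G x)].
Proof. by move=> Ox xy; have [] := VP (Om_V Ox xy). Qed.

Let h n k x := if x == y then 0 else profile beta r n (G x) * lie (X k) G x.

Let cutoff_near n : \forall x \near y, x <> y -> cutoff n (G x) = 0.
Proof.
have [_ _ lim0] := hG.
have n0 : 0 < (n%:R + 1 : R)^-1 by rewrite invr_gt0 ltr_wpDl.
have : \forall x \near y^', (G x)^-1 < (n%:R + 1)^-1.
  by move/(@cvgr_lt _ _ _ _ _) : lim0; apply.
have /open_nbhs_nbhs nT : open_nbhs y T by split => //; case: hG => -[].
move=> near_lt.
have {}near_lt : nbhs y [set x | x != y -> (G x)^-1 < (n%:R + 1)^-1] := near_lt.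
apply: filterS2 nT near_lt => x Tx /= hx xy.
have Gx : 0 < G x by apply: G_gt0.
have /hx : x != y by exact/eqP.
move=> /ltW; rewrite lef_pV2 ?posrE ?ltr_wpDl// => Gn.
rewrite /cutoff step0// subr_le0 ler_pdivrMr// mul1r (le_trans _ Gn)//.
by rewrite lerDl.
Qed.

Let h_near n k : \forall x \near y, h n k x = 0.
Proof.
apply: filterS (cutoff_near n) => x hx; rewrite /h; case: eqP => // /hx.
by rewrite /profile => ->; rewrite !mul0r.
Qed.

Let C1h_V n k : C1 X V (h n k).
Proof.
have VT : V `<=` T `\ y by move=> x [].
apply: (@C1_eq _ _ _ _ _ _ _ ((profile beta r n \o G) \* lie (X k) G)) => //.
  by move=> x [[_ /eqP/negPf xy] _] /=; rewrite /h xy.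
apply: C1_M => //; last exact: C1_sub (C1lG k).
apply: (@C1_comp _ _ _ _ _ _ _ _ (profile' beta r n)) => //.
- exact: C1_sub C1G.
- by move=> x /VP[_ ? ? ?]; exact: is_derive_profile.
- by move=> x /VP[_ ? ? ?]; exact: continuous_profile'.
Qed.

Let C1h n k : C1 X Om (h n k).
Proof.
pose Z := ([set x | h n k x = 0])^°.
have oZ : open Z by exact: open_interior.
have oZO : open (Om `&` Z) by exact: openI.
apply: (@C1_sub _ _ _ _ _ _ ((Om `&` V) `|` (Om `&` Z))).
  move=> x Ox; have [xy|xy] := pselect (x = y); [right|left]; split => //.
    by rewrite /Z xy; exact: h_near.
  exact: Om_V.
apply: C1_setU; first exact: C1_sub (C1h_V n k).
apply: (@C1_eq _ _ _ _ _ _ _ (cst 0)) => //.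
  by move=> x [_ /interior_subset].
by apply: C1_cst => // k' x [Ox _]; exact: flOm.
Qed.

Let ch n k x : closure Om x -> {for x, continuous (h n k)} /\ {for x, continuous (lie (X k) (h n k))}.
Proof.
move=> cx; have [->|xy] := pselect (x = y); last first.
  have Vx := closure_V cx xy.
  by split; [exact: C1_continuous (C1h_V n k) Vx|exact: C1_lie_continuous (C1h_V n k) Vx].
have E := h_near n k.
split; apply: (@near_eq_for_continuous _ _ (cst 0)); try exact: cvg_cst.
  by apply: filterS E => z ->.
by apply: filterS (nbhs_interior E) => z Ez; apply/esym/lie_eq0; exact: Ez.
Qed.

Let u2 := (v \* v) \+ (w \* w).
Let f n k := u2 \* h n k.
Let gq x := \sum_(k < N) (lie (X k) v x ^+ 2 + lie (X k) w x ^+ 2).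

Let C1u2 : C1 X Om u2. Proof. by apply: C1_D => //; exact: C1_M. Qed.

Let cu2 : {within closure Om, continuous u2}.
Proof. by apply: within_continuousD; exact: within_continuousM. Qed.

Let u2_ge0 x : 0 <= u2 x.
Proof. by rewrite /u2 /= addr_ge0// -expr2 sqr_ge0. Qed.

Let lie_u2 k x : Om x -> lie (X k) u2 x = 2 * (v x * lie (X k) v x + w x * lie (X k) w x).
Proof.
move=> Ox; rewrite (lie_D _ (C1_M oOm C1v C1v) (C1_M oOm C1w C1w) Ox).
by rewrite (lie_M _ C1v C1v Ox) (lie_M _ C1w C1w Ox); ring.
Qed.

Let C1f n k : C1 X Om (f n k). Proof. exact: C1_M. Qed.

Let lie_f n k x : Om x -> lie (X k) (f n k) x =
  u2 x * lie (X k) (h n k) x +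
  h n k x * (2 * (v x * lie (X k) v x + w x * lie (X k) w x)).
Proof. by move=> Ox; rewrite (lie_M _ C1u2 (C1h n k) Ox) lie_u2. Qed.

Let cf n k : {within closure Om, continuous (f n k)}.
Proof.
apply: within_continuousM; first exact: cu2.
by apply: within_continuous_for => x cx; case: (ch n k cx).
Qed.

Let cgq x : Om x -> {for x, continuous gq}.
Proof.
move=> Ox; apply: for_continuous_sum => k.
by apply: for_continuousD; apply: for_continuous_sqr; apply: C1_lie_continuous Ox.
Qed.

Let gq_ge0 x : 0 <= gq x.
Proof. by apply: sumr_ge0 => k _; rewrite addr_ge0 ?sqr_ge0. Qed.

Let cOm : compact (closure Om). Proof. by case: hOm. Qed.

Section FiniteEnergy.
Hypothesis fin : nu.-integrable Om (EFin \o gq).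

Let intf n k : nu.-integrable Om (EFin \o lie (X k) (f n k)).
Proof.
have [C1 C10 hC1] := bounded_within cOm cu2.
have [C2 C20 hC2] := bounded_within cOm (within_continuous_for (fun x cx => proj1 (ch n k cx))).
have [C3 C30 hC3] := bounded_within cOm (within_continuous_for (fun x cx => proj2 (ch n k cx))).
have i1 : nu.-integrable Om (EFin \o (fun x => (C1 * C3 + C2 * C1) + C2 * gq x)).
  have ic : nu.-integrable Om (EFin \o cst (C1 * C3 + C2 * C1)).
    apply: integrable_bounded => //; first exact: admissible_finite hOm.
    by exists `|C1 * C3 + C2 * C1|.
  exact: (integrableD mOm ic (integrableZl mOm C2 fin)).
apply: (le_integrable mOm _ _ i1).
  apply/measurable_EFinP; apply: measurable_for_continuous => // x Ox.
  exact: C1_lie_continuous (C1f n k) Ox.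
move=> x Ox; have cx := subset_closure Ox.
have := hC1 x cx; have := hC2 x cx; have := hC3 x cx.
rewrite /= lee_fin lie_f//; set a := u2 x; set b := h n k x; set l := lie _ (h n k) x.
move=> hl hb ha.
have u20 := u2_ge0 x; have gq0 := gq_ge0 x.
have g_ge : lie (X k) v x ^+ 2 + lie (X k) w x ^+ 2 <= gq x.
  rewrite /gq (bigD1 k)//= lerDl; apply: sumr_ge0 => j _; rewrite addr_ge0 ?sqr_ge0//.
rewrite [leRHS]ger0_norm; last by rewrite addr_ge0 ?mulr_ge0// addr_ge0 ?mulr_ge0.
apply: (le_trans (ler_normD _ _)); rewrite -addrA lerD//.
  by rewrite normrM ler_pM.
rewrite normrM -mulrDr ler_pM//.
apply: le_trans (_ : a + gq x <= _); last first.
  by rewrite lerD2r; apply: le_trans ha; exact: ler_norm.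
apply: le_trans (_ : a + (lie (X k) v x ^+ 2 + lie (X k) w x ^+ 2) <= _); last by rewrite lerD2l.
rewrite /a /u2 /=; set p := lie _ v x; set q := lie _ w x.
have h1 := sqr_ge0 (v x - p); have h2 := sqr_ge0 (v x + p).
have h3 := sqr_ge0 (w x - q); have h4 := sqr_ge0 (w x + q).
by rewrite ler_norml; apply/andP; split; nra.
Qed.

Let wbd x := (G x)^-1 * u2 x.
Let wlog' x := (G x)^-1 * (L x)^-1 * u2 x.
Let Bd := 1 / 2 * boundary_int P wbd (grad_field X G) +
          kap * boundary_int P wlog' (grad_field X G).

Let bdy_V x : boundary Om x -> V x.
Proof. by move=> bx; apply: closure_V; [case: bx|move=> xy; apply: hy; rewrite -xy]. Qed.

Let within_bdy (g : M -> R) : (forall x, V x -> {for x, continuous g}) ->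
  {within boundary Om, continuous g}.
Proof. by move=> cg; apply: within_continuous_for => x /bdy_V; exact: cg. Qed.

Let boundary_terms : exists n0, forall n, (n0 <= n)%N ->
  \sum_k boundary_int P (f n k) (X k) = Bd.
Proof.
have bc : boundary Om `<=` closure Om by move=> x [].
have cb : compact (boundary Om).
  apply: (subclosed_compact _ cOm bc); rewrite /boundary setDE; apply: closedI.
    exact: closed_closure.
  by apply: open_closedC; exact: open_interior.
have cGb : {within boundary Om, continuous G}.
  by apply: within_bdy => x /VP[Tx _ _ _]; exact: cG.
have [C C0 hC] := bounded_within cb cGb.
have [n0 hn0] : exists n0 : nat, 2 * C <= n0%:R.
  by exists (Num.bound (2 * C)); apply: ltW; apply: archi_boundP; rewrite mulr_ge0.
exists n0 => n n0n; rewrite /Bd -boundary_int_grad.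
- apply: eq_bigr => k _; apply: boundary_int_eq => x bx.
  have [[_ /eqP/negPf xy] Gx _ _] := VP (bdy_V bx).
  rewrite /f /h /= xy /profile /cutoff step1.
    by rewrite /wbd /wlog' /coefa /L /kap; ring.
  rewrite lerBrDr ler_pdivlMr//.
  apply: (@le_trans _ _ (2 * C)).
    by rewrite -[1 + 1]/2 ler_pM2l//; apply: le_trans (hC x bx); exact: ler_norm.
  by apply: le_trans hn0 _; rewrite ler_nat.
- apply: within_continuousM.
    apply: within_bdy => x /VP[Tx Gx _ _].
    by apply: (@continuous_comp _ _ _ G (fun t => t^-1)); [exact: cG|exact: continuous_inv].
  by apply: continuous_subspaceW cu2.
- apply: within_continuousM; last by apply: continuous_subspaceW cu2.
  apply: within_bdy => x /VP[Tx Gx r0 Lx]; apply: for_continuousM.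
    by apply: (@continuous_comp _ _ _ G (fun t => t^-1)); [exact: cG|exact: continuous_inv].
  apply: (@continuous_comp _ _ _ G (fun t => (ell beta r t)^-1)); first exact: cG.
  exact: continuous_ellV.
- move=> k; apply: within_bdy => x /VP[Tx _ _ _]; exact: (C1_lie_continuous C1G Tx).
Qed.

Let S x := (1 / 4 + kap ^+ 2 * (L x) ^- 2) * (G x) ^- 2 * gradsq X G x * u2 x.
Let cS n x := if x == y then 0 else cutoff n (G x) * S x.

Let S_ge0 x : V x -> 0 <= S x.
Proof.
move=> /VP[_ Gx _ Lx]; have i2 (t : R) : 0 <= t ^- 2 by rewrite invr_ge0 sqr_ge0.
rewrite /S; apply: mulr_ge0 (u2_ge0 x); apply: mulr_ge0; last first.
  by apply: sumr_ge0 => k _; exact: sqr_ge0.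
apply: mulr_ge0 => //; apply: addr_ge0; first by rewrite divr_ge0.
by apply: mulr_ge0 => //; exact: sqr_ge0.
Qed.

Let cS_ge0 n x : Om x -> 0 <= cS n x.
Proof.
move=> Ox; rewrite /cS; case: eqP => // xy; rewrite mulr_ge0 ?step_ge0//.
exact/S_ge0/Om_V.
Qed.

Let lie_h n k x : V x -> lie (X k) (h n k) x =
  profile beta r n (G x) * lie (X k) (lie (X k) G) x +
  lie (X k) G x * (profile' beta r n (G x) * lie (X k) G x).
Proof.
move=> Vx; have [Tx Gx r0 Lx] := VP Vx.
have E : \near x, h n k x = ((profile beta r n \o G) \* lie (X k) G) x.
  apply: open_near_eq oV _ Vx => z /VP[[_ /eqP/negPf zy] _ _ _].
  by rewrite /h zy.
have C1p : C1 X V (profile beta r n \o G).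
  apply: (@C1_comp _ _ _ _ _ _ _ _ (profile' beta r n)) => //.
  - by apply: C1_sub C1G => z [].
  - by move=> z /VP[_ ? ? ?]; exact: is_derive_profile.
  - by move=> z /VP[_ ? ? ?]; exact: continuous_profile'.
have C1l : C1 X V (lie (X k) G) by apply: C1_sub (C1lG k) => z [].
rewrite (lie_near _ E) (lie_M _ C1p C1l Vx) (lie_comp _ C1G Tx (is_derive_profile hbeta r0 n Gx Lx)).
by [].
Qed.

Let divergence_le n x : Om x -> \sum_k lie (X k) (f n k) x + cS n x <= gq x.
Proof.
move=> Ox; have [xy|xy] := eqVneq x y.
  rewrite /cS xy eqxx addr0 big1 => [|k _]; first by rewrite -xy.
  rewrite -xy lie_f// {2}/h xy eqxx mul0r addr0 (lie_eq0 _ (h_near n k)).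
  by rewrite mulr0.
have Vx := Om_V Ox (elimN eqP xy); have [Tx Gx r0 Lx] := VP Vx.
rewrite /cS (negPf xy).
set c := cutoff n (G x); set c' := cutoff' n (G x).
set a := coefa beta r (G x); set a' := coefa' beta r (G x).
have -> : S x = \sum_k (- a' - a ^+ 2) * lie (X k) G x ^+ 2 * u2 x.
  by rewrite -mulr_suml -mulr_sumr /a' /a coefa_identity.
have c'0 : c' <= 0 := cutoff'_le0 n (G x).
have a0 : 0 <= a by exact: coefa_ge0.
have c0 : 0 <= c by exact: step_ge0.
have c1 : c <= 1 by exact: step_le1.
have key k : lie (X k) (f n k) x + c * ((- a' - a ^+ 2) * lie (X k) G x ^+ 2 * u2 x) <=
    (lie (X k) v x ^+ 2 + lie (X k) w x ^+ 2) +
    u2 x * c * a * lie (X k) (lie (X k) G) x.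
  rewrite lie_f// lie_h// /h (negPf xy) /profile /profile' -/c -/c' -/a -/a'.
  have u20 := u2_ge0 x; have u2E : u2 x = v x * v x + w x * w x by [].
  set g := lie _ G x; set p := lie _ v x; set q := lie _ w x; set gg := lie _ (lie _ G) x.
  have s1 : 0 <= (p - a * g * v x) ^+ 2 + (q - a * g * w x) ^+ 2 by rewrite addr_ge0 ?sqr_ge0.
  have s2 : u2 x * g ^+ 2 * a * c' <= 0.
    by rewrite mulr_ge0_le0// mulr_ge0// mulr_ge0// sqr_ge0.
  have s3 : 0 <= c * ((p - a * g * v x) ^+ 2 + (q - a * g * w x) ^+ 2) by rewrite mulr_ge0.
  have s4 : 0 <= (1 - c) * (p ^+ 2 + q ^+ 2).
    by rewrite mulr_ge0 ?subr_ge0// addr_ge0 ?sqr_ge0.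
  rewrite -subr_ge0; apply: le_trans (_ : 0 <= c * ((p - a * g * v x) ^+ 2 +
    (q - a * g * w x) ^+ 2) + (1 - c) * (p ^+ 2 + q ^+ 2) + - (u2 x * g ^+ 2 * a * c')) _.
    by rewrite !addr_ge0// oppr_ge0.
  by rewrite le_eqVlt; apply/orP; left; apply/eqP; rewrite u2E; ring.
rewrite mulr_sumr -big_split/=.
apply: le_trans (_ : \sum_k ((lie (X k) v x ^+ 2 + lie (X k) w x ^+ 2) +
    u2 x * c * a * lie (X k) (lie (X k) G) x) <= _); first by apply: ler_sum => k _; exact: key.
by rewrite big_split/= -mulr_sumr -/(sumsq X G x) LG0 ?mulr0 ?addr0//; exact/eqP.
Qed.

Let ccS n x : Om x -> {for x, continuous (cS n)}.
Proof.
move=> Ox; have [->|xy] := eqVneq x y.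
  apply: (@near_eq_for_continuous _ _ (cst 0)); last exact: cvg_cst.
  apply: filterS (cutoff_near n) => z hz; rewrite /cS; case: eqP => // /hz ->.
  by rewrite mul0r.
have Vx := Om_V Ox (elimN eqP xy); have [Tx Gx r0 Lx] := VP Vx.
apply: (@near_eq_for_continuous _ _ (fun x => cutoff n (G x) * S x)).
  by apply: open_near_eq oV _ Vx => z /VP[[_ /eqP/negPf zy] _ _ _]; rewrite /cS zy.
have cGx := cG Tx.
have cI : {for x, continuous (fun z => (G z) ^- 2)}.
  have -> : (fun z => (G z) ^- 2) = (fun z => ((G z)^-1) ^+ 2).
    by apply/funext => z; rewrite exprVn.
  apply: for_continuous_sqr.
  by apply: (@continuous_comp _ _ _ G (fun t => t^-1)); [|exact: continuous_inv].
have cL : {for x, continuous (fun z => (L z) ^- 2)}.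
  have -> : (fun z => (L z) ^- 2) = (fun z => ((L z)^-1) ^+ 2).
    by apply/funext => z; rewrite exprVn.
  apply: for_continuous_sqr.
  apply: (@continuous_comp _ _ _ G (fun t => (ell beta r t)^-1)) => //.
  exact: continuous_ellV.
apply: for_continuousM.
  by apply: (@continuous_comp _ _ _ G (cutoff n)) => //; exact: continuous_cutoff.
apply: for_continuousM; last exact: C1_continuous C1u2 Ox.
apply: for_continuousM.
  apply: for_continuousM => //; apply: for_continuousD; first exact: cvg_cst.
  exact: for_continuousZ.
by apply: for_continuous_sum => k; apply: for_continuous_sqr; exact: (C1_lie_continuous C1G Tx).
Qed.

Let E := \int[nu]_(x in Om) gq x.

Let integral_cS : exists n0, forall n, (n0 <= n)%N ->
  (\int[nu]_(x in Om) (cS n x)%:E <= (E - Bd)%:E)%E.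
Proof.
have [n0 hn0] := boundary_terms; exists n0 => n n0n.
have [iS eS] := Rintegral_sum (index_enum 'I_N) mOm (intf n).
have iD : nu.-integrable Om (EFin \o (fun x => gq x - \sum_k lie (X k) (f n k) x)).
  exact: (integrableB mOm fin iS).
have le x : Om x -> cS n x <= gq x - \sum_k lie (X k) (f n k) x.
  by move=> Ox; rewrite lerBrDl; exact: divergence_le.
have icS : nu.-integrable Om (EFin \o cS n).
  apply: (le_integrable mOm _ _ iD).
    by apply/measurable_EFinP; apply: measurable_for_continuous => // x; exact: ccS.
  move=> x Ox; rewrite /= lee_fin ger0_norm; last exact: cS_ge0.
  by apply: le_trans (le x Ox) _; exact: ler_norm.
have := le_Rintegral mOm icS iD le.
rewrite RintegralB// eS -/E.
have [_ _ _ div] := hOm.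
rewrite (div (f n) (fun k => @C1f n k) (fun k => @cf n k) (fun k => @intf n k)) hn0// => leR.
by rewrite -[leLHS]fineK ?integrable_fin_num// lee_fin.
Qed.

Lemma hardy_interior : (\int[nu]_(x in Om `\ y) (S x)%:E <= (E - Bd)%:E)%E.
Proof.
have my : measurable ([set y] : set (borel M)).
  by rewrite -(setCK [set y]); apply: measurableC; exact: open_measurable_borel.
have mD : measurable (Om `\ y : set (borel M)) by exact: measurableD.
have mcS n : measurable_fun (Om : set (borel M)) (EFin \o (cS n : borel M -> R)).
  by apply/measurable_EFinP; apply: measurable_for_continuous => // x; exact: ccS.
have mcS' n : measurable_fun (Om `\ y : set (borel M)) (EFin \o (cS n : borel M -> R)).
  by apply: measurable_funS (mcS n) => // x [].
have cvgS := @cvg_monotone_convergence _ _ _ nu _ mD (fun n => EFin \o cS n) mcS' _ _.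
have limS x : (Om `\ y) x -> limn (fun n => (EFin \o cS n) x) = (S x)%:E.
  move=> [Ox xy]; have Vx := Om_V Ox xy; have [Tx Gx _ _] := VP Vx.
  apply: lim_near_cst; first exact: ereal_hausdorff.
  exists (Num.bound (2 * G x)) => // n /= hn.
  rewrite /cS ifF; last exact/eqP.
  rewrite /cutoff step1 ?mul1r// lerBrDr ler_pdivlMr//.
  rewrite -[1 + 1]/2; apply: ltW; apply: lt_le_trans (archi_boundP _) _.
    by rewrite mulr_ge0// ltW.
  by rewrite ler_nat.
have <- : (\int[nu]_(x in Om `\ y) limn (fun n => (EFin \o cS n) x) =
    \int[nu]_(x in Om `\ y) (S x)%:E)%E.
  by apply: eq_integral => x /set_mem; exact: limS.
have [n0 hn0] := integral_cS.
apply: cvge_le (cvgS _ _).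
- exists n0 => // n /= n0n; apply: le_trans (hn0 n n0n).
  apply: (@ge0_subset_integral _ _ _ nu _ _ mD mOm _ (mcS n)) => [x Ox|x []//].
  by rewrite /= lee_fin; exact: cS_ge0.
- by move=> n x [Ox _]; rewrite /= lee_fin; exact: cS_ge0.
- move=> x [Ox xy] n1 n2 n12; have /eqP/negPf xyF := xy; rewrite /= lee_fin /cS xyF.
  have Vx := Om_V Ox xy; have [Tx Gx _ _] := VP Vx.
  rewrite ler_wpM2r//; first exact: S_ge0.
  by apply: step_nd; rewrite lerD2r ler_pM2r ?invr_gt0// ler_nat.
Qed.
End FiniteEnergy.
End Hardy.

(** * The weighted inequality *)

Lemma measurable_inve_continuous {R : realType} {M : ptopologicalType}
    (D : set M) (g : M -> R) : open D -> (forall x, D x -> {for x, continuous g}) ->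
  measurable_fun (D : set (borel M)) (fun x : borel M => ((g x)%:E^-1)%E).
Proof.
move=> oD cg; have mD : measurable (D : set (borel M)) by exact: open_measurable_borel.
pose D1 : set (borel M) := D `&` [set x | g x != 0].
have oD1 : @open M D1.
  rewrite openE => x [Dx gx]; apply: filterI; first exact: open_nbhs_nbhs.
  have : g z @[z --> x] --> g x by exact: cg.
  by move/cvgr_neq0; apply.
have mD1 : measurable D1 by exact: open_measurable_borel.
have mD0 : measurable (D `\` D1 : set (borel M)) by exact: measurableD.
have DE : D = (D `\` D1) `|` D1 by rewrite setUC setDUK// => x [].
rewrite DE; apply/measurable_funU => //; split.
  apply: (@eq_measurable_fun _ _ _ _ _ (cst +oo%E)) => [x|]; last exact: measurable_cst.
  rewrite inE => -[Dx nx]; rewrite inver ifT//; apply/negPn/negP => gx.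
  by apply: nx; split.
apply: (@eq_measurable_fun _ _ _ _ _ (EFin \o (fun x : borel M => (g x)^-1))) => [x|].
  by rewrite inE => -[Dx gx]; rewrite inver (negPf gx).
apply/measurable_EFinP; apply: measurable_for_continuous => // x [Dx gx].
by apply: (@continuous_comp _ _ _ g (fun t => t^-1)); [exact: cg|exact: inv_continuous].
Qed.

Lemma sqr_le_of_amgm {R : realType} (I W Q : R) : 0 <= I -> 0 <= W -> 0 <= Q ->
  (forall t, 0 < t -> 2 * I <= t * W + Q / t) -> I ^+ 2 <= Q * W.
Proof.
move=> I0 W0 Q0 h; have [->|In0] := eqVneq I 0; first by rewrite expr0n/= mulr_ge0.
have Ip : 0 < I by rewrite lt_neqAle eq_sym In0.
have [W00|Wn0] := eqVneq W 0.
  have := h ((Q + 1) / I); rewrite W00 mulr0 add0r divr_gt0 ?ltr_wpDl// => /(_ isT).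
  rewrite invf_div mulrA ler_pdivlMr ?ltr_wpDl//; nra.
have Wp : 0 < W by rewrite lt_neqAle eq_sym Wn0.
have := h (I / W); rewrite divr_gt0// => /(_ isT).
rewrite divfK// invf_div mulrA.
have -> : 2 * I = I + I by ring.
by rewrite lerD2l ler_pdivlMr// expr2.
Qed.

Section WeightedInequality.
Context d (T : measurableType d) {R : realType} (mu : {measure set T -> \bar R}).
Local Open Scope ereal_scope.

Lemma weighted_inequality (D : set T) (q hl mid : T -> R) (wt : T -> \bar R)
    (c b1 b2 : R) (E : \bar R) :
  measurable D -> (0 < c)%R -> 0 <= E ->
  measurable_fun D q -> measurable_fun D hl -> measurable_fun D mid -> measurable_fun D wt ->
  (forall x, D x -> (0 <= q x)%R) -> (forall x, D x -> (0 <= hl x)%R) ->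
  (forall x, D x -> (0 <= mid x)%R) -> (forall x, D x -> 0 <= wt x) ->
  (E < +oo -> \int[mu]_(x in D) (c * q x + 1 / 4 * hl x)%:E <= (fine E - (b1 + b2))%:E) ->
  (forall x t, D x -> (0 < t)%R -> (2 * mid x)%:E <= t%:E * wt x + (q x / t)%:E) ->
  (forall x, D x -> wt x = 0 -> mid x = 0%R) ->
  ~ (\int[mu]_(x in D) wt x = +oo /\ E = 0) ->
  c%:E * (\int[mu]_(x in D) (mid x)%:E) ^+ 2
    + (1 / 4)%:E * \int[mu]_(x in D) (hl x)%:E * \int[mu]_(x in D) wt x
    + b1%:E * \int[mu]_(x in D) wt x + b2%:E * \int[mu]_(x in D) wt x
  <= \int[mu]_(x in D) wt x * E.
Proof.
move=> mD c0 E0 mq mhl mmid mwt q0 hl0 mid0 wt0 hE amgm midwt nindet.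
have W0 : 0 <= \int[mu]_(x in D) wt x by exact: integral_ge0.
have I0 : 0 <= \int[mu]_(x in D) (mid x)%:E by apply: integral_ge0 => x Dx; rewrite lee_fin mid0.
have eW0 : \int[mu]_(x in D) wt x = 0 -> \int[mu]_(x in D) (mid x)%:E = 0.
  move=> W00; have : \int[mu]_(x in D) `|wt x| = 0.
    by rewrite -[RHS]W00; apply: eq_integral => x /set_mem Dx; rewrite gee0_abs// wt0.
  move/(ae_eq_integral_abs mu mD mwt) => ae0.
  rewrite -(integral0 mu D); apply: ae_eq_integral => //; first exact/measurable_EFinP.
  by apply: filterS ae0 => x /= wx Dx; rewrite midwt// wx.
have [W00|Wn0] := eqVneq (\int[mu]_(x in D) wt x) 0.
  by rewrite (eW0 W00) W00 expe2 !mule0 mul0e !add0e.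
have Wp : 0 < \int[mu]_(x in D) wt x by rewrite lt_neqAle eq_sym Wn0.
have [Eoo|Efin] := eqVneq E +oo.
  by rewrite Eoo gt0_muley// leey.
have {}Efin : E < +oo by rewrite ltey.
have EE : E = (fine E)%:E by rewrite fineK// ge0_fin_numE.
have [Woo|Wfin] := eqVneq (\int[mu]_(x in D) wt x) +oo.
  have En0 : E != 0 by apply/eqP => E00; apply: nindet.
  by rewrite [leRHS](_ : _ = +oo) ?leey// Woo gt0_mulye// lt_neqAle eq_sym En0.
have {}Wfin : \int[mu]_(x in D) wt x < +oo by rewrite ltey.
have mqe : measurable_fun D (EFin \o q) by exact/measurable_EFinP.
have mhe : measurable_fun D (EFin \o hl) by exact/measurable_EFinP.
have mme : measurable_fun D (EFin \o mid) by exact/measurable_EFinP.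
have Q0 : 0 <= \int[mu]_(x in D) (q x)%:E by apply: integral_ge0 => x Dx; rewrite lee_fin q0.
have H0 : 0 <= \int[mu]_(x in D) (hl x)%:E by apply: integral_ge0 => x Dx; rewrite lee_fin hl0.
have QH : c%:E * \int[mu]_(x in D) (q x)%:E + (1 / 4)%:E * \int[mu]_(x in D) (hl x)%:E <=
    (fine E - (b1 + b2))%:E.
  apply: le_trans (hE Efin); rewrite -!ge0_integralZl_EFin//; last by exact: ltW.
  rewrite -ge0_integralD//.
  - by move=> x Dx; rewrite -EFinM lee_fin mulr_ge0 ?q0// ltW.
  - exact: measurable_funeM.
  - by move=> x Dx; rewrite -EFinM lee_fin mulr_ge0 ?hl0.
  - exact: measurable_funeM.
have Qfin : \int[mu]_(x in D) (q x)%:E < +oo.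
  rewrite ltey; apply/eqP => Qoo; move: QH; rewrite Qoo gt0_muley ?lte_fin//.
  by rewrite addye ?leye_eq// gt_eqF// (lt_le_trans (ltNyr 0%R))// mule_ge0.
have Hfin : \int[mu]_(x in D) (hl x)%:E < +oo.
  rewrite ltey; apply/eqP => Hoo; move: QH; rewrite Hoo gt0_muley ?lte_fin//.
  by rewrite addey ?leye_eq// gt_eqF// (lt_le_trans (ltNyr 0%R))// mule_ge0// lee_fin ltW.
have amgmI t : (0 < t)%R -> 2%:E * \int[mu]_(x in D) (mid x)%:E <=
    t%:E * \int[mu]_(x in D) wt x + (t^-1)%:E * \int[mu]_(x in D) (q x)%:E.
  move=> t0; have ti0 : (0 <= t^-1)%R by rewrite invr_ge0 ltW.
  rewrite -!ge0_integralZl_EFin//; last by exact: ltW.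
  rewrite -ge0_integralD//.
  - apply: ge0_le_integral => //.
    + by move=> x Dx; rewrite -EFinM lee_fin mulr_ge0 ?mid0.
    + exact: measurable_funeM.
    + by apply: emeasurable_funD; exact: measurable_funeM.
    + by move=> x Dx; rewrite -!EFinM [(t^-1 * _)%R]mulrC; exact: amgm.
  - by move=> x Dx; rewrite mule_ge0 ?wt0// lee_fin ltW.
  - exact: measurable_funeM.
  - by move=> x Dx; rewrite -EFinM lee_fin mulr_ge0 ?q0.
  - exact: measurable_funeM.
have Ifin : \int[mu]_(x in D) (mid x)%:E < +oo.
  rewrite ltey; apply/eqP => Ioo; have := amgmI 1%R ltr01; rewrite Ioo gt0_muley ?lte_fin//.
  rewrite leye_eq => /eqP; apply/eqP; rewrite lt_eqF// lte_add_pinfty//.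
    by rewrite mul1e.
  by rewrite invr1 mul1e.
have finK (z : \bar R) : 0 <= z -> z < +oo -> z = (fine z)%:E.
  by move=> z0 zoo; rewrite fineK// ge0_fin_numE.
have f0 (z : \bar R) : 0 <= z -> (0 <= fine z)%R by exact: fine_ge0.
move: QH amgmI; rewrite (finK _ I0 Ifin) (finK _ W0 Wfin) (finK _ Q0 Qfin) (finK _ H0 Hfin) EE.
have := f0 _ I0; have := f0 _ W0; have := f0 _ Q0; have := f0 _ H0.
move: (fine (\int[mu]_(x in D) (mid x)%:E)) => I.
move: (fine (\int[mu]_(x in D) wt x)) => W.
move: (fine (\int[mu]_(x in D) (q x)%:E)) => Q.
move: (fine (\int[mu]_(x in D) (hl x)%:E)) => H.
move: (fine E) => e /= H0' Q0' W0' I0' QH amgmI.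
rewrite -!EFinM -EFinD lee_fin in QH.
rewrite -!EFinM -!EFinD lee_fin.
have I2 : (I ^+ 2 <= Q * W)%R.
  apply: sqr_le_of_amgm => // t t0; have := amgmI t t0.
  by rewrite -!EFinM -EFinD lee_fin [(t^-1 * _)%R]mulrC.
have h1 : (c * (I * I) <= c * (Q * W))%R by rewrite ler_pM2l// -expr2.
have h2 : (W * (c * Q + 1 / 4 * H) <= W * (e - (b1 + b2)))%R by rewrite ler_wpM2l.
lra.
Qed.
End WeightedInequality.

Local Open Scope ereal_scope.

Theorem corollary3p3 (R : realType) (m : nat) (M : ptopologicalType)
  (A : manifold R m.+1 M)
  (dnu : volume_form A) (nu : {measure set (borel M) -> \bar R})
  (hnu : volume_measure dnu nu)
  (N : nat) (hN : (N <= m.+1)%N) (X : 'I_N -> vector_field A)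
  (y : M) (T : set M) (G : M -> R) (hG : assumption_Aplus X nu T y G)
  (Om : set M) (P : boundary_patches dnu Om)
  (hOm : admissible_domain X nu P)
  (hOmT : closure Om `<=` T) (hy : ~ boundary Om y)
  (u : M -> R[i]) (hu1 : C1C X Om u)
  (hu0 : {within closure Om, continuous (@complex.Re R \o u)} /\
         {within closure Om, continuous (@complex.Im R \o u)})
  (beta : R) (hbeta : (2 < beta)%R) (r : R)
  (hr : (expR 1)%:E *
        ereal_sup [set (G x `^ (1 / (2 - beta)))%R%:E | x in Om `\ y] <= r%:E) :
  let d := (fun x => G x `^ (1 / (2 - beta)))%R in
  let d2 := (fun x => G x `^ (2 / (2 - beta)))%R in
  let log := (fun x => ln (r / d x))%R in
  let u2 := (fun x => sqmod (u x)) in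
  let energy := \int[nu]_(x in Om) (gradsqC X u x)%:E in
  let hardy_log :=
    \int[nu]_(x in Om) (gradsq X d x / d2 x * (log x) ^- 2 * u2 x)%R%:E in
  let bd_log :=
    boundary_int P (fun x => (G x)^-1 * (log x)^-1 * u2 x)%R (grad_field X G) in
  let bd := boundary_int P (fun x => (G x)^-1 * u2 x)%R (grad_field X G) in
  let W1 := \int[nu]_(x in Om) (d2 x * gradsq X d x * u2 x)%R%:E in
  let W2 := \int[nu]_(x in Om)
    ((d2 x)%:E / (gradsq X d x)%:E * (u2 x)%:E) in
  (W1 * energy >=
     (((beta - 2) / 2) ^+ 2)%R%:E *
       (\int[nu]_(x in Om) (gradsq X d x * u2 x)%R%:E) ^+ 2
     + (1 / 4)%R%:E * hardy_log * W1
     + (1 / (2 * (beta - 2)) * bd_log)%R%:E * W1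
     + (1 / 2 * bd)%R%:E * W1)
  /\
  (* excluded: the indeterminate left-hand side oo * 0 *)
  (~ (W2 = +oo /\ energy = 0) ->
   W2 * energy >=
     (((beta - 2) / 2) ^+ 2)%R%:E *
       (\int[nu]_(x in Om) (u2 x)%:E) ^+ 2
     + (1 / 4)%R%:E * hardy_log * W2
     + (1 / (2 * (beta - 2)) * bd_log)%R%:E * W2
     + (1 / 2 * bd)%R%:E * W2).
Proof.
move=> d d2 log u2 energy hardy_log bd_log bd W1 W2.
have [[[oT Ty [C1G C2G] _] G_gt0 _] [oOm cOm _ _]] := (hG, hOm).
have [C1v C1w] := hu1; have [cv cw] := hu0.
pose v := @complex.Re R \o u; pose w := @complex.Im R \o u.
have hr' x : Om x -> x <> y -> (expR 1 * G x `^ (1 / (2 - beta)) <= r)%R.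
  move=> Ox xy; rewrite -lee_fin EFinM; apply: le_trans hr.
  rewrite lee_wpmul2l ?lee_fin ?expR_ge0//; apply: ereal_sup_ubound.
  by exists x.
have facts x : (Om `\ y) x -> [/\ (0 < G x)%R, (0 < r)%R & (0 < log x)%R].
  by move=> [Ox xy]; exact: (radius_facts hG hOmT hr' Ox xy).
have oy : open (~` [set y]).
  rewrite openC; apply: accessible_closed_set1; apply: hausdorff_accessible; exact: man_hausdorff A.
pose D : set (borel M) := Om `\ y.
have oD : @open M D by exact: openI.
have OmT : Om `<=` T by move=> x Ox; apply: hOmT; exact: subset_closure.
have DT : D `<=` T `\ y by move=> x [/OmT].
have mOm : measurable (Om : set (borel M)) by exact: open_measurable_borel.
have my : measurable ([set y] : set (borel M)).
  by rewrite -(setCK [set y]); apply: measurableC; exact: open_measurable_borel.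
have mD : measurable D by exact: measurableD.
have toD (F : borel M -> \bar R) : measurable_fun D F -> (forall x, 0 <= F x) ->
    \int[nu]_(x in Om) F x = \int[nu]_(x in D) F x.
  move=> mF F0; apply: ge0_negligible_integral => //; last exact: nu_set1 hnu.
  exact (@measurable_fun_setD1 M _ _ Om y F mOm my mF).
have CDG : C1 X D G by exact: C1_sub C1G.
have DG x : D x -> (0 < G x)%R by move=> /facts[].
have d_gt0 x : D x -> (0 < d x)%R by move=> /DG Gx; exact: powR_gt0.
pose e : R := (1 / (2 - beta))%R.
have CDd : C1 X D d.
  apply: (@C1_comp _ _ _ _ _ _ _ (fun t => t `^ e)%R (fun t => e * t `^ (e - 1))%R) => //.
    by move=> x /DG Gx; exact: is_derive1_powR.
  move=> x /DG Gx; apply: for_continuousZ.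
  apply/differentiable_continuous/derivable1_diffP.
  by case: (is_derive1_powR (e - 1)%R Gx).
have d2E x : D x -> d2 x = (d x ^+ 2)%R.
  move=> /DG Gx; rewrite /d2 /d expr2 -powRD; last by rewrite (gt_eqF Gx) implybT.
  by rewrite -mulrDl.
have d2_gt0 x : D x -> (0 < d2 x)%R by move=> /DG Gx; exact: powR_gt0.
have lied k x : D x -> lie (X k) d x = (e * (d x / G x) * lie (X k) G x)%R.
  move=> Dx; have Gx := DG x Dx.
  rewrite (@lie_comp _ _ _ _ _ _ D (fun t => t `^ e)%R (fun t => e * t `^ (e - 1))%R _ _ _ CDG Dx (is_derive1_powR e Gx)).
  rewrite powRB; last by rewrite (gt_eqF Gx) implybT.
  by rewrite powRr1 ?ltW.
have gradE x : D x -> (gradsq X d x / d2 x = e ^+ 2 * (G x) ^- 2 * gradsq X G x)%R.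
  move=> Dx; have Gn0 : G x != 0%R by rewrite gt_eqF ?DG.
  have dn0 : d x != 0%R by rewrite gt_eqF ?d_gt0.
  rewrite d2E// /gradsq mulr_suml mulr_sumr; apply: eq_bigr => k _.
  by rewrite lied//; field; rewrite Gn0 dn0.
have gq0 x : (0 <= gradsq X d x)%R by apply: sumr_ge0 => k _; exact: sqr_ge0.
have u20 x : (0 <= u2 x)%R by rewrite /u2 /sqmod addr_ge0// sqr_ge0.
have d20 x : (0 <= d2 x)%R by exact: powR_ge0.
pose q x := (gradsq X d x / d2 x * u2 x)%R.
pose hl x := (gradsq X d x / d2 x * (log x) ^- 2 * u2 x)%R.
have q0 x : (0 <= q x)%R by rewrite mulr_ge0// divr_ge0.
have hl0 x : (0 <= hl x)%R.
  by apply: mulr_ge0 => //; apply: mulr_ge0; [rewrite divr_ge0|rewrite invr_ge0 sqr_ge0].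
have cgq x : D x -> {for x, continuous (gradsq X d)}.
  move=> Dx; apply: for_continuous_sum => k; apply: for_continuous_sqr.
  exact: C1_lie_continuous CDd Dx.
have cu2 x : D x -> {for x, continuous u2}.
  move=> [Ox _]; apply: for_continuousD; apply: for_continuous_sqr.
    exact: C1_continuous C1v Ox.
  exact: C1_continuous C1w Ox.
have cd2 x : D x -> {for x, continuous d2}.
  move=> Dx; apply: (@near_eq_for_continuous _ _ (fun z => d z ^+ 2)%R).
    by apply: open_near_eq oD _ Dx => z /d2E ->.
  by apply: for_continuous_sqr; exact: C1_continuous CDd Dx.
have cV (g : M -> R) x : {for x, continuous g} -> (0 < g x)%R -> {for x, continuous (fun z => (g z)^-1)%R}.
  by move=> cg gx; apply: (@continuous_comp _ _ _ g (fun t => t^-1)%R) => //; exact: continuous_inv.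
have clog x : D x -> {for x, continuous log}.
  move=> Dx; have [Gx r0 Lx] := facts x Dx.
  apply: (@continuous_comp _ _ _ G (ell beta r)); first exact: C1_continuous CDG Dx.
  exact: continuous_ell.
have cq x : D x -> {for x, continuous q}.
  move=> Dx; apply: for_continuousM (cu2 x Dx); apply: for_continuousM; first exact: cgq.
  by apply: cV; [exact: cd2|exact: d2_gt0].
have chl x : D x -> {for x, continuous hl}.
  move=> Dx; apply: for_continuousM (cu2 x Dx); apply: for_continuousM.
    apply: for_continuousM; first exact: cgq.
    by apply: cV; [exact: cd2|exact: d2_gt0].
  have [_ _ Lx] := facts x Dx.
  apply: (cV (fun z => log z ^+ 2)%R); last by rewrite exprn_gt0.
  by apply: for_continuous_sqr; exact: clog.
have meas (g : M -> R) : (forall x, D x -> {for x, continuous g}) ->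
    measurable_fun D (g : borel M -> R) by exact: measurable_for_continuous.
have E0 : 0 <= energy.
  apply: integral_ge0 => x _; rewrite lee_fin; apply: sumr_ge0 => k _.
  by rewrite /sqmod addr_ge0// sqr_ge0.
pose c : R := (((beta - 2) / 2) ^+ 2)%R.
have b2 : (0 < beta - 2)%R by rewrite subr_gt0.
have c0 : (0 < c)%R by rewrite exprn_gt0// divr_gt0.
have hE : energy < +oo -> \int[nu]_(x in D) (c * q x + 1 / 4 * hl x)%:E <=
    (fine energy - (1 / (2 * (beta - 2)) * bd_log + 1 / 2 * bd))%:E.
  move=> Efin.
  have fin : nu.-integrable Om (EFin \o (fun x => \sum_(k < N) (lie (X k) v x ^+ 2 + lie (X k) w x ^+ 2))%R).
    apply/integrableP; split.
      apply/measurable_EFinP; apply: measurable_for_continuous => // x Ox.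
      apply: for_continuous_sum => k; apply: for_continuousD; apply: for_continuous_sqr.
        exact: C1_lie_continuous C1v Ox.
      exact: C1_lie_continuous C1w Ox.
    apply: le_lt_trans Efin; rewrite le_eqVlt; apply/orP; left; apply/eqP.
    apply: eq_integral => x _; rewrite gee0_abs//= lee_fin.
    by apply: sumr_ge0 => k _; rewrite addr_ge0// sqr_ge0.
  have := hardy_interior hnu hOm hG hOmT hy C1v C1w cv cw hbeta hr' fin.
  rewrite [(1 / (2 * (beta - 2)) * bd_log + _)%R]addrC.
  apply: le_trans; rewrite le_eqVlt; apply/orP; left; apply/eqP.
  apply: eq_integral => x /set_mem Dx; congr EFin.
  rewrite /hl /q gradE// /c /e /log.
  have [Gx _ Lx] := facts x Dx.
  have Gn0 : G x != 0%R by rewrite gt_eqF.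
  have Ln0 : ln (r / d x) != 0%R by rewrite gt_eqF.
  have bn0 : (beta - 2)%R != 0%R by rewrite gt_eqF.
  have bn1 : (2 - beta)%R != 0%R by rewrite -opprB oppr_eq0.
  rewrite /= -[(_ * _ + _ * _)%R]/(u2 x) -[ell beta r (G x)]/(ln (r / d x)).
  by field; rewrite Gn0 Ln0 bn0 bn1.
have EH : hardy_log = \int[nu]_(x in D) (hl x)%:E.
  apply: toD => [|x]; last by rewrite lee_fin; exact: hl0.
  by apply/measurable_EFinP; exact: meas.
split.
  have E1 : \int[nu]_(x in Om) (gradsq X d x * u2 x)%:E = \int[nu]_(x in D) (gradsq X d x * u2 x)%:E.
    apply: toD => [|x]; last by rewrite lee_fin mulr_ge0.
    apply/measurable_EFinP; apply: meas => x Dx.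
    by apply: for_continuousM; [exact: cgq|exact: cu2].
  have cw1 x : D x -> {for x, continuous (fun x => d2 x * gradsq X d x * u2 x)%R}.
    move=> Dx; apply: for_continuousM (cu2 x Dx).
    by apply: for_continuousM; [exact: cd2|exact: cgq].
  have EW1 : W1 = \int[nu]_(x in D) (d2 x * gradsq X d x * u2 x)%:E.
    apply: toD => [|x]; last by rewrite lee_fin !mulr_ge0.
    by apply/measurable_EFinP; exact: meas.
  rewrite E1 EW1 EH; apply: weighted_inequality (@c0) (@E0) _ _ _ _ _ _ _ _ (@hE) _ _ _ => //.
  - exact: meas.
  - exact: meas.
  - by apply: meas => x Dx; apply: for_continuousM; [exact: cgq|exact: cu2].
  - by apply/measurable_EFinP; exact: meas.
  - by move=> x _; rewrite mulr_ge0.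
  - by move=> x _; rewrite lee_fin !mulr_ge0.
  - move=> x t Dx t0; rewrite -EFinM -EFinD lee_fin /q.
    have s0 := d2_gt0 x Dx; have tn0 : t != 0%R by rewrite gt_eqF.
    have sn0 : d2 x != 0%R by rewrite gt_eqF.
    rewrite -subr_ge0 [leRHS](_ : _ = (gradsq X d x * u2 x * ((t * d2 x - 1) ^+ 2 / (t * d2 x)))%R).
      apply: mulr_ge0; first exact: mulr_ge0.
      by apply: divr_ge0; [exact: sqr_ge0|rewrite mulr_ge0// ltW].
    by field; rewrite sn0 tn0.
  - move=> x Dx [/eqP]; rewrite -mulrA mulf_eq0 gt_eqF/=; last exact: d2_gt0.
    by move/eqP.
  - move=> [Woo E00].
    have := hE; rewrite E00 ltry => /(_ isT) hQ.
    pose rho : R := (r / expR 1)%R.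
    have r4c : (0 <= rho ^+ 4 / c)%R by rewrite divr_ge0 ?(ltW c0)// -[4%N]/(2 * 2)%N exprM sqr_ge0.
    have le1 : \int[nu]_(x in D) (d2 x * gradsq X d x * u2 x)%:E <=
        \int[nu]_(x in D) ((rho ^+ 4 / c)%:E * (c * q x + 1 / 4 * hl x)%:E).
      apply: ge0_le_integral => //.
      + by move=> x _; rewrite lee_fin !mulr_ge0.
      + by apply/measurable_EFinP; exact: meas.
      + apply: measurable_funeM; apply/measurable_EFinP; apply: meas => x Dx.
        by apply: for_continuousD; apply: for_continuousZ; [exact: cq|exact: chl].
      + move=> x Dx; rewrite -EFinM lee_fin.
        have dx := d_gt0 x Dx; have cn0 : c != 0%R by exact: lt0r_neq0.
        have dn0 : d x != 0%R by exact: lt0r_neq0.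
        have -> : (d2 x * gradsq X d x * u2 x = d x ^+ 4 * q x)%R.
          by rewrite /q d2E//; field.
        have dr : (d x <= rho)%R.
          by rewrite /rho ler_pdivlMr ?expR_gt0// mulrC; case: Dx => Ox xy; exact: hr'.
        have -> : (rho ^+ 4 / c * (c * q x + 1 / 4 * hl x) = rho ^+ 4 * q x + rho ^+ 4 / c * (1 / 4 * hl x))%R.
          by field.
        rewrite -[leLHS]addr0 lerD//; last by apply: mulr_ge0 => //; exact: mulr_ge0.
        rewrite ler_wpM2r//; apply: lerXn2r => //; rewrite nnegrE; first exact: ltW.
        exact: le_trans (ltW dx) dr.
    move: le1; rewrite Woo ge0_integralZl_EFin//; last 2 first.
    + by move=> x _; rewrite lee_fin addr_ge0// mulr_ge0// ltW.
    + apply/measurable_EFinP; apply: meas => x Dx.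
      by apply: for_continuousD; apply: for_continuousZ; [exact: cq|exact: chl].
    rewrite leye_eq => /eqP; apply/eqP; rewrite lt_eqF//.
    apply: le_lt_trans (_ : _ <= (rho ^+ 4 / c)%:E * _) _; first exact: lee_wpmul2l hQ.
    by rewrite -EFinM ltry.
move=> nindet.
have E1 : \int[nu]_(x in Om) (u2 x)%:E = \int[nu]_(x in D) (u2 x)%:E.
  apply: toD => [|x]; last by rewrite lee_fin.
  by apply/measurable_EFinP; exact: meas.
pose wt x := (d2 x)%:E / (gradsq X d x)%:E * (u2 x)%:E.
have wt0 x : 0 <= wt x by rewrite !mule_ge0// ?lee_fin// inve_ge0 lee_fin.
have mwt : measurable_fun D (wt : borel M -> \bar R).
  apply: emeasurable_funM; last by apply/measurable_EFinP; exact: meas.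
  apply: emeasurable_funM; first by apply/measurable_EFinP; exact: meas.
  exact: measurable_inve_continuous.
have EW2 : W2 = \int[nu]_(x in D) wt x by exact: toD.
rewrite E1 EW2 EH; rewrite EW2 in nindet.
apply: weighted_inequality (@c0) (@E0) _ _ _ _ _ _ _ _ (@hE) _ _ nindet => //.
- exact: meas.
- exact: meas.
- exact: meas.
- move=> x t Dx t0; have s0 := d2_gt0 x Dx; have tn0 : t != 0%R by rewrite gt_eqF.
  have sn0 : d2 x != 0%R by rewrite gt_eqF.
  rewrite /wt inver; case: eqVneq => [g0|gn0].
    rewrite /q g0 !mul0r adde0 gt0_muley ?lte_fin//.
    have [->|un0] := eqVneq (u2 x) 0%R; first by rewrite mulr0 !mule0.
    by rewrite gt0_mulye ?lte_fin ?lt_neqAle 1?eq_sym ?un0 ?u20// gt0_muley ?lte_fin// leey.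
  have gp : (0 < gradsq X d x)%R by rewrite lt_neqAle eq_sym gn0 gq0.
  rewrite -!EFinM -EFinD lee_fin /q.
  rewrite -subr_ge0 [leRHS](_ : _ = (u2 x * ((t * d2 x - gradsq X d x) ^+ 2 / (t * d2 x * gradsq X d x)))%R).
    apply: mulr_ge0 => //.
    by apply: divr_ge0; [exact: sqr_ge0|rewrite !mulr_ge0// ltW].
  by field; rewrite sn0 tn0 gn0.
- move=> x Dx; have s0 := d2_gt0 x Dx; rewrite /wt inver; case: eqVneq => [g0|gn0].
    rewrite gt0_muley ?lte_fin// => /eqP; rewrite mule_eq0/= eqe.
    by move/eqP.
  move=> [/eqP]; rewrite mulf_eq0 mulf_eq0 invr_eq0 (negPf gn0) gt_eqF//=.
  by move/eqP.
Qed.
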